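(* Let $\zeta$ be a stationary particle process on $\mathbb{H}^d$ with intensity measure $\Lambda$ and with intensity $\gamma\in(0,\infty)$ (with respect to a given center function $c_h$). Then there exists a unique probability measure $\mathbf{Q}$ on $\mathcal{C}^d$ which is concentrated on $\mathcal{C}^d_{\mathsf p}$, invariant under isometries fixing $\mathsf p$, and satisfies $$\Lambda=\gamma\int_{\mathcal{C}^d}\int_{\mathcal{I}_d}\mathbf{1}\{\varrho K\in\cdot\}\,\lambda(d\varrho)\,\mathbf{Q}(dK).$$ This measure is given by $$\mathbf{Q}=\frac1\gamma\int_{\mathcal{C}^d}\int_{\mathcal{I}_d}\mathbf{1}\{\varrho^{-1}K\in\cdot\}\,w(c_h(K))\,\kappa(c_h(K),d\varrho)\,\Lambda(dK),$$ where $w\colon\mathbb{H}^d\to[0,\infty)$ is any measurable function with $\int_{\mathbb{H}^d}w(x)\,\mathcal{H}^d(dx)=1$.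
   Context: $\mathbb{H}^d$ ($d\ge 2$) is $d$-dimensional hyperbolic space of constant curvature $-1$, $\mathsf p\in\mathbb{H}^d$ is a fixed point, and $\mathcal{H}^d$ is the $d$-dimensional Hausdorff measure (the Riemannian volume). $\mathcal{I}_d$ is the isometry group of $\mathbb{H}^d$ (compact-open topology). $\lambda$ is the Haar measure on $\mathcal{I}_d$ (left, right and inversion invariant), normalized such that $\mathcal{H}^d=\int_{\mathcal{I}_d}\mathbf{1}\{\varrho x\in\cdot\}\,\lambda(d\varrho)$ for all $x\in\mathbb{H}^d$. Kernel $\kappa$: let $\mathcal{I}_d(\mathsf p,x)=\{\varrho\in\mathcal{I}_d:\varrho\mathsf p=x\}$ and $\mathcal{I}_d(\mathsf p)=\mathcal{I}_d(\mathsf p,\mathsf p)$, a compact group. $\kappa(\mathsf p,\cdot)$ is the invariant (Haar) probability measure on $\mathcal{I}_d(\mathsf p)$, extended by $0$ to $\mathcal{I}_d$. For $x\in\mathbb{H}^d$ choose any $\varrho_x\in\mathcal{I}_d(\mathsf p,x)$ and put $\kappa(x,B)=\int_{\mathcal{I}_d(\mathsf p)}\mathbf{1}\{\varrho_x\circ\varrho\in B\}\,\kappa(\mathsf p,d\varrho)$ for Borel $B\subseteq\mathcal{I}_d$; this does not depend on the choice of $\varrho_x$ and defines a probability kernel from $\mathbb{H}^d$ to $\mathcal{I}_d$. $\mathcal{C}^d$ is the space of nonempty compact subsets of $\mathbb{H}^d$ with the Hausdorff metric and its Borel $\sigma$-field; $[C]=\{K\in\mathcal{C}^d:K\cap C\ne\varnothing\}$.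 A particle process is a point process $\zeta$ on $\mathcal{C}^d$ with $\zeta([C])<\infty$ almost surely for all compact $C$. It is stationary if $\varrho\zeta\overset{d}{=}\zeta$ for all $\varrho\in\mathcal{I}_d$, where $\varrho\zeta$ is the image of $\zeta$ under $K\mapsto\varrho K$. Its intensity measure is $\Lambda=\mathbf{E}\zeta$. A center function is a measurable map $c_h\colon\mathcal{C}^d\to\mathbb{H}^d$ with $c_h(\varrho K)=\varrho c_h(K)$ for all $K\in\mathcal{C}^d$, $\varrho\in\mathcal{I}_d$. The intensity (with respect to $c_h$) is $\gamma=\int_{\mathcal{C}^d}\mathbf{1}\{c_h(K)\in\mathbb{B}\}\,\Lambda(dK)$, where $\mathbb{B}$ is a ball of volume $1$. Finally $\mathcal{C}^d_{\mathsf p}=\{K\in\mathcal{C}^d:c_h(K)=\mathsf p\}$. *)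

(* Defs.v *)
From HB Require Import structures.
From mathcomp Require Import all_boot all_order all_algebra.
From mathcomp Require Import finmap.
From mathcomp Require Import all_classical all_reals all_analysis measurable_realfun.
From mathcomp Require Import ring lra.

Set Implicit Arguments.
Unset Strict Implicit.
Unset Printing Implicit Defensive.

Import Order.TTheory GRing.Theory Num.Theory.
Import numFieldTopology.Exports numFieldNormedType.Exports.

Local Open Scope classical_set_scope.
Local Open Scope ring_scope.

Section hyperbolic_space.
Context (R : realType) (d : nat).

Definition lorentz (x y : 'rV[R]_d.+1) : R :=
  - (x 0 0 * y 0 0) + \sum_(i < d) x 0 (lift 0 i) * y 0 (lift 0 i).

(* Hyperboloid model: the upper sheet of <x, x> = -1 for the Lorentz form. *)
Record hyperbolic := Hyperbolic {
  hval :> 'rV[R]_d.+1;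
  hvalP : (lorentz hval hval == -1) && (0 < hval 0 0) }.

HB.instance Definition _ := [isSub for hval].
HB.instance Definition _ := [Choice of hyperbolic by <:].

Definition arcosh (t : R) : R := ln (t + Num.sqrt (t ^+ 2 - 1)).

Definition hdist (x y : hyperbolic) : R := arcosh (- lorentz x y).

Lemma lorentzC x y : lorentz x y = lorentz y x.
Proof.
rewrite /lorentz mulrC; congr (_ + _).
by apply: eq_bigr => i _; rewrite mulrC.
Qed.

Lemma lorentzBl a b x y z :
  lorentz (a *: x - b *: y) z = a * lorentz x z - b * lorentz y z.
Proof.
rewrite /lorentz !mxE.
under eq_bigr do rewrite !mxE mulrBl -!mulrA.
rewrite sumrB -!mulr_sumr; ring.
Qed.

Lemma lorentzBr a b x y z :
  lorentz z (a *: x - b *: y) = a * lorentz z x - b * lorentz z y.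
Proof. by rewrite lorentzC lorentzBl ![lorentz z _]lorentzC. Qed.

Lemma discriminant_le (X Y S : R) :
  (forall a b, 0 <= a ^+ 2 * X - 2 * (a * b * S) + b ^+ 2 * Y) ->
  S ^+ 2 <= X * Y.
Proof.
move=> H.
have Y0 : 0 <= Y by have := H 0 1; lra.
have [Yp|] := ltP 0 Y.
  have := H Y S.
  have -> : Y ^+ 2 * X - 2 * (Y * S * S) + S ^+ 2 * Y = Y * (X * Y - S ^+ 2).
    by ring.
  by rewrite pmulr_rge0 // subr_ge0.
move=> Yn; have Ye : Y = 0 by lra.
rewrite {}Ye in H *.
have [->|S0] := eqVneq S 0; first by rewrite mulr0 expr0n.
have := H 1 ((X + 1) / (2 * S)).
have -> : 1 ^+ 2 * X - 2 * (1 * ((X + 1) / (2 * S)) * S) +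
          ((X + 1) / (2 * S)) ^+ 2 * 0 = - 1 by field.
by move=> h; exfalso; lra.
Qed.

Lemma cauchy_schwarz_sum (n : nat) (u v : 'I_n -> R) :
  (\sum_i u i * v i) ^+ 2 <= (\sum_i u i * u i) * (\sum_i v i * v i).
Proof.
apply: discriminant_le => a b.
rewrite [_ * (\sum_i u i * u i)]mulr_sumr mulr_sumr.
rewrite [2 * _]mulr_sumr [_ * (\sum_i v i * v i)]mulr_sumr.
rewrite -sumrB -big_split; apply: sumr_ge0 => i _ /=.
have -> : a ^+ 2 * (u i * u i) - 2 * (a * b * (u i * v i)) + b ^+ 2 * (v i * v i)
   = (a * u i - b * v i) ^+ 2 by ring.
exact: sqr_ge0.
Qed.

Lemma hyperbolicE (y : hyperbolic) :
  \sum_(i < d) hval y 0 (lift 0 i) * hval y 0 (lift 0 i) =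
  hval y 0 0 ^+ 2 - 1.
Proof.
have /andP[/eqP] := hvalP y; rewrite /lorentz => + _.
move/(canRL (addNKr _)) => ->; ring.
Qed.

Lemma hyperbolic_gt0 (y : hyperbolic) : 0 < hval y 0 0.
Proof. by have /andP[] := hvalP y. Qed.

Lemma hyperbolic_lorentz (y : hyperbolic) : lorentz y y = -1.
Proof. by have /andP[/eqP] := hvalP y. Qed.

Lemma lorentz_orth (u : 'rV[R]_d.+1) (y : hyperbolic) :
  lorentz u y = 0 ->
  \sum_(i < d) u 0 (lift 0 i) * u 0 (lift 0 i) <=
  lorentz u u * hval y 0 0 ^+ 2.
Proof.
move=> /eqP; rewrite /lorentz addrC subr_eq0 => /eqP uy.
have := cauchy_schwarz_sum (fun i => u 0 (lift 0 i)) (fun i => hval y 0 (lift 0 i)).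
rewrite uy hyperbolicE.
set U := \sum_i _; set y0 := hval y 0 0; set u0 := u 0 0; lra.
Qed.

Lemma lorentz_orth_ge0 (u : 'rV[R]_d.+1) (y : hyperbolic) :
  lorentz u y = 0 -> 0 <= lorentz u u.
Proof.
move=> /lorentz_orth h.
have : 0 <= lorentz u u * hval y 0 0 ^+ 2.
  by apply: le_trans h; apply: sumr_ge0 => i _; rewrite -expr2 sqr_ge0.
by rewrite pmulr_lge0 // exprn_gt0 // hyperbolic_gt0.
Qed.

Lemma lorentz_orth_eq0 (u : 'rV[R]_d.+1) (y : hyperbolic) :
  lorentz u y = 0 -> lorentz u u = 0 -> u = 0.
Proof.
move=> uy uu; have := lorentz_orth uy; rewrite uu mul0r => U0.
have Ue : \sum_(i < d) u 0 (lift 0 i) * u 0 (lift 0 i) = 0.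
  apply/eqP; rewrite eq_le U0 /=.
  by apply: sumr_ge0 => i _; rewrite -expr2 sqr_ge0.
have u0 : u 0 0 = 0.
  by move: uu; rewrite /lorentz Ue addr0 => /eqP; rewrite oppr_eq0 mulf_eq0 orbb => /eqP.
apply/rowP => j; rewrite mxE.
have [|->] := unliftP 0 j; last by [].
move=> i ->.
have /psumr_eq0P h : forall i : 'I_d, true -> 0 <= u 0 (lift 0 i) * u 0 (lift 0 i).
  by move=> k _; rewrite -expr2 sqr_ge0.
by have /eqP := h Ue i isT; rewrite mulf_eq0 orbb => /eqP.
Qed.

Lemma hcosh_ge1 (x y : hyperbolic) : 1 <= - lorentz x y.
Proof.
set t := - lorentz x y.
have t2 : 1 <= t ^+ 2.
  have o : lorentz (1 *: (x : 'rV_ _) - t *: (y : 'rV_ _)) y = 0.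
    by rewrite lorentzBl hyperbolic_lorentz /t; ring.
  have := lorentz_orth_ge0 o.
  rewrite lorentzBr o lorentzBl [lorentz y x]lorentzC hyperbolic_lorentz.
  have -> : lorentz x y = - t by rewrite /t opprK.
  lra.
have t0 : 0 <= t.
  rewrite /t /lorentz opprD opprK subr_ge0.
  have xy0 : 0 <= hval x 0 0 * hval y 0 0 by rewrite mulr_ge0 // ltW // hyperbolic_gt0.
  rewrite (le_trans (ler_norm _)) // -(ler_pXn2r (n := 2)) // ?nnegrE //.
  rewrite real_normK ?num_real//.
  apply: le_trans (cauchy_schwarz_sum _ _) _; rewrite !hyperbolicE exprMn.
  apply: ler_pM; rewrite ?gerBl // -hyperbolicE; by apply: sumr_ge0 => i _; rewrite -expr2 sqr_ge0.
by rewrite -(ler_pXn2r (n := 2)) ?nnegrE // expr1n.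
Qed.

Lemma hdistxx x : hdist x x = 0.
Proof.
by rewrite /hdist /arcosh hyperbolic_lorentz opprK expr1n subrr sqrtr0 addr0 ln1.
Qed.

Lemma hdist_sym x y : hdist x y = hdist y x.
Proof. by rewrite /hdist lorentzC. Qed.

Lemma hdist_positivity x y : hdist x y = 0 -> x = y.
Proof.
have t1 := hcosh_ge1 x y; move: t1.
rewrite /hdist /arcosh; set t := - lorentz x y => t1 /eqP.
rewrite ln_eq0 ?ltr_wpDr ?sqrtr_ge0 ?(lt_le_trans _ t1) // => /eqP te.
have {}te : t = 1.
  apply/eqP; rewrite eq_le t1 andbT -te lerDl; exact: sqrtr_ge0.
have xy : lorentz x y = -1 by rewrite -te /t opprK.
have o : lorentz (1 *: (x : 'rV_ _) - 1 *: (y : 'rV_ _)) y = 0.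
  by rewrite lorentzBl hyperbolic_lorentz xy; ring.
have : 1 *: (x : 'rV_ _) - 1 *: (y : 'rV_ _) = 0.
  apply: (lorentz_orth_eq0 o).
  rewrite lorentzBr o lorentzBl [lorentz y x]lorentzC hyperbolic_lorentz xy; ring.
by move/eqP; rewrite !scale1r subr_eq0 => /eqP /val_inj.
Qed.

Lemma hdist_triangle y x z : hdist x z <= hdist x y + hdist y z.
Proof.
rewrite /hdist /arcosh.
set p := - lorentz x y; set q := - lorentz y z; set r := - lorentz x z.
have p1 : 1 <= p := hcosh_ge1 x y.
have q1 : 1 <= q := hcosh_ge1 y z.
have r1 : 1 <= r := hcosh_ge1 x z.
set a := Num.sqrt (p ^+ 2 - 1); set b := Num.sqrt (q ^+ 2 - 1).
have a0 : 0 <= a by exact: sqrtr_ge0.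
have b0 : 0 <= b by exact: sqrtr_ge0.
have sq1 (t : R) : 1 <= t -> 0 <= t ^+ 2 - 1.
  by move=> t1; rewrite subr_ge0 exprn_ege1.
have a2 : a ^+ 2 = p ^+ 2 - 1 by rewrite sqr_sqrtr // sq1.
have b2 : b ^+ 2 = q ^+ 2 - 1 by rewrite sqr_sqrtr // sq1.
have rle : r <= p * q + a * b.
  pose u := 1 *: (x : 'rV_ _) - p *: (y : 'rV_ _).
  pose v := 1 *: (z : 'rV_ _) - q *: (y : 'rV_ _).
  have xy : lorentz x y = - p by rewrite /p opprK.
  have yz : lorentz y z = - q by rewrite /q opprK.
  have xz : lorentz x z = - r by rewrite /r opprK.
  have yx : lorentz y x = - p by rewrite lorentzC.
  have zy : lorentz z y = - q by rewrite lorentzC.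
  have uy : lorentz u y = 0 by rewrite lorentzBl hyperbolic_lorentz xy; ring.
  have vy : lorentz v y = 0 by rewrite lorentzBl hyperbolic_lorentz zy; ring.
  have uu : lorentz u u = p ^+ 2 - 1.
    by rewrite /u !(lorentzBr, lorentzBl) !hyperbolic_lorentz xy yx; ring.
  have vv : lorentz v v = q ^+ 2 - 1.
    by rewrite /v !(lorentzBr, lorentzBl) !hyperbolic_lorentz zy yz; ring.
  have uv : lorentz u v = p * q - r.
    by rewrite /v /u !(lorentzBr, lorentzBl) !hyperbolic_lorentz xy yz xz; ring.
  clearbody u v.
  have : (lorentz u v) ^+ 2 <= lorentz u u * lorentz v v.
    apply: discriminant_le => s t.
    have o : lorentz (s *: u - t *: v) y = 0 by rewrite lorentzBl uy vy; ring.
    have := lorentz_orth_ge0 o.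
    rewrite !(lorentzBr, lorentzBl) [lorentz v u]lorentzC; lra.
  rewrite uu vv uv -a2 -b2 -exprMn => h.
  have ab0 : 0 <= a * b by rewrite mulr_ge0.
  have : `|p * q - r| <= a * b.
    by rewrite -(ler_pXn2r (n := 2)) // ?nnegrE // real_normK ?num_real.
  by rewrite ler_norml => /andP[]; lra.
have p0 : 0 < p + a by lra.
have q0 : 0 < q + b by lra.
rewrite -lnM ?posrE //.
have r0 : 0 < r + Num.sqrt (r ^+ 2 - 1).
  by rewrite ltr_wpDr ?sqrtr_ge0 //; lra.
rewrite ler_ln ?posrE ?mulr_gt0 //.
have -> : (p + a) * (q + b) = (p * q + a * b) + (p * b + a * q) by ring.
apply: lerD => //.
have h0 : 0 <= p * b + a * q by rewrite addr_ge0 // mulr_ge0 //; lra.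
rewrite -(ler_pXn2r (n := 2)) ?nnegrE ?sqrtr_ge0 // sqr_sqrtr ?sq1 //.
have -> : (p * b + a * q) ^+ 2 = (p * q + a * b) ^+ 2 - 1.
  transitivity (p ^+ 2 * b ^+ 2 + a ^+ 2 * q ^+ 2 + 2 * (p * q * a * b)); first by ring.
  transitivity (p ^+ 2 * q ^+ 2 + a ^+ 2 * b ^+ 2 + 2 * (p * q * a * b) - 1); last by ring.
  rewrite a2 b2; ring.
rewrite lerD2r ler_pXn2r // nnegrE; lra.
Qed.

HB.instance Definition _ := @isMetric.Build R hyperbolic hdist
  hdistxx hdist_positivity hdist_sym hdist_triangle.

Definition hbase_vec : 'rV[R]_d.+1 := \row_i (i == 0)%:R.

Lemma hbase_subproof :
  (lorentz hbase_vec hbase_vec == -1) && (0 < hbase_vec 0 0).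
Proof.
rewrite /lorentz !mxE eqxx ltr01 andbT mulr1 big1 ?addr0 // => i _.
by rewrite !mxE mul0r.
Qed.

HB.instance Definition _ := isPointed.Build hyperbolic (Hyperbolic hbase_subproof).

HB.instance Definition _ := Measurable.copy hyperbolic
  (g_sigma_algebraType (@open hyperbolic)).

End hyperbolic_space.

Section hausdorff_measure.
Context (R : realType) (d : nat).
Local Notation H := (hyperbolic R d).
Local Open Scope ereal_scope.

(* Lebesgue measure of the Euclidean unit ball of dimension [n], through the
   recursion v_(n+2) = 2 pi / (n + 2) v_n. *)
Fixpoint unit_ball_volume (n : nat) : R :=
  match n with
  | 0 => 1%R
  | 1 => 2%R
  | n'.+2 => ((2 * pi) / n'.+2%:R * unit_ball_volume n')%R
  end.

(* [ediam set0 = -oo]. *)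
Definition ediam (A : set H) : \bar R :=
  ereal_sup [set (mdist x y)%:E | x in A & y in A].

(* The factor [unit_ball_volume d / 2 ^ d] makes the [d]-dimensional Hausdorff
   measure of [hyperbolic R d] coincide with the Riemannian volume. *)
Definition hausdorff_gauge (A : set H) : \bar R :=
  if A == set0 then 0
  else (unit_ball_volume d / 2 ^+ d)%:E * ediam A ^+ d.

Definition hausdorff_cover (delta : R) (A : set H) : set (set H)^nat :=
  [set F | A `<=` \bigcup_n F n /\ forall n, ediam (F n) <= delta%:E].

Definition hausdorff_premeasure (delta : R) (A : set H) : \bar R :=
  ereal_inf [set \sum_(n <oo) hausdorff_gauge (F n) | F in hausdorff_cover delta A].

Definition hausdorff_measure (A : set H) : \bar R :=
  ereal_sup [set hausdorff_premeasure delta A | delta in [set e : R | (0 < e)%R]].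

Lemma unit_ball_volume_ge0 n : (0 <= unit_ball_volume n)%R.
Proof.
have [] // : (0 <= unit_ball_volume n)%R /\ (0 <= unit_ball_volume n.+1)%R.
elim: n => [|m IH]; first by split.
have h1 := IH.1; have h2 := IH.2; split=> //=.
by rewrite mulr_ge0 // divr_ge0 // mulr_ge0 // pi_ge0.
Qed.

Lemma hausdorff_gauge0 : hausdorff_gauge set0 = 0.
Proof. by rewrite /hausdorff_gauge eqxx. Qed.

Lemma hausdorff_gauge_ge0 A : 0 <= hausdorff_gauge A.
Proof.
rewrite /hausdorff_gauge; case: eqP => // /eqP/set0P[x Ax].
rewrite mule_ge0 //.
  by rewrite lee_fin divr_ge0 ?exprn_ge0 // unit_ball_volume_ge0.
apply: expe_ge0; apply: ereal_sup_ubound; exists x => //; exists x => //.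
by rewrite mdistxx.
Qed.

Lemma ediam_set0 : ediam set0 = -oo.
Proof.
rewrite /ediam -[RHS]ereal_sup0; congr ereal_sup.
by rewrite -subset0 => _ [x []].
Qed.

Lemma hausdorff_premeasure_ge0 delta A : 0 <= hausdorff_premeasure delta A.
Proof.
apply: le_ereal_inf_tmp => _ [F _ <-].
by apply: nneseries_ge0 => n _ _; exact: hausdorff_gauge_ge0.
Qed.

Lemma hausdorff_premeasure0 delta : hausdorff_premeasure delta set0 = 0.
Proof.
apply/eqP; rewrite eq_le hausdorff_premeasure_ge0 andbT.
apply: ereal_inf_lbound; exists (fun=> set0).
  by split=> // n; rewrite ediam_set0 leNye.
by rewrite eseries0 // => n _ _; exact: hausdorff_gauge0.
Qed.

Lemma le_hausdorff_premeasure delta A B : A `<=` B ->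
  hausdorff_premeasure delta A <= hausdorff_premeasure delta B.
Proof.
move=> AB; apply: le_ereal_inf_tmp => _ [F [BF Fd] <-].
by apply: ereal_inf_lbound; exists F => //; split=> //; exact: subset_trans BF.
Qed.

Lemma hausdorff_premeasure_anti (delta eps : R) A : (delta <= eps)%R ->
  hausdorff_premeasure eps A <= hausdorff_premeasure delta A.
Proof.
move=> de; apply: le_ereal_inf_tmp => _ [F [AF Fd] <-].
apply: ereal_inf_lbound; exists F => //; split=> // n.
by rewrite (le_trans (Fd n)) // lee_fin.
Qed.

Lemma hausdorff_premeasure_sigma_subadditive delta :
  sigma_subadditive (hausdorff_premeasure delta).
Proof.
move=> A; have [[i ioo]|] := pselect (exists i, hausdorff_premeasure delta (A i) = +oo).
  rewrite (eseries_pinfty _ _ ioo) ?leey// => n _.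
  by rewrite -ltNye (lt_le_trans _ (hausdorff_premeasure_ge0 _ _)).
rewrite -forallNE => Aoo.
suff add2e (e : {posnum R}) :
    hausdorff_premeasure delta (\bigcup_n A n) <=
    \sum_(i <oo) hausdorff_premeasure delta (A i) + e%:num%:E.
  by apply/lee_addgt0Pr => _/posnumP[].
rewrite (le_trans _ (epsilon_trick _ _ _))//; last first.
  by move=> n; exact: hausdorff_premeasure_ge0.
pose P n (B : (set H)^nat) := hausdorff_cover delta (A n) B /\
  \sum_(k <oo) hausdorff_gauge (B k) <=
    hausdorff_premeasure delta (A n) + (e%:num / (2 ^ n.+1)%:R)%:E.
have [G PG] : {G : ((set H)^nat)^nat & forall n, P n (G n)}.
  apply: (@choice _ _ P) => n; rewrite /P.
  have fn : hausdorff_premeasure delta (A n) \is a fin_num.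
    by rewrite ge0_fin_numE ?hausdorff_premeasure_ge0 // ltey; exact/eqP.
  have en1 : (0 < e%:num / (2 ^ n.+1)%:R)%R by [].
  have [x [B AnB muBx] xS] := lb_ereal_inf_adherent en1 fn.
  by exists B; split => //; rewrite muBx; exact/ltW.
have muG_ge0 x : 0 <= (hausdorff_gauge \o uncurry G) x.
  exact: hausdorff_gauge_ge0.
apply: (@le_trans _ _ (\esum_(i in setT) (hausdorff_gauge \o uncurry G) i)).
  apply: ereal_inf_lbound => /=.
  have /card_esym/ppcard_eqP[f] := card_nat2.
  exists (uncurry G \o f).
    split => [t [i _ /(PG i).1.1 [j _ Bijt]]|i]; last first.
      by move: (PG (f i).1).1.2 => /(_ (f i).2) /=; case: (f i).
    by exists (f^-1%FUN (i, j)) => //=; rewrite invK ?inE.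
  rewrite -(esum_pred_image (hausdorff_gauge \o uncurry G) _ xpredT) ?[fun=> _]set_true//.
  by rewrite image_eq.
rewrite (_ : esum _ _ = \sum_(i <oo) \sum_(j <oo ) hausdorff_gauge (G i j)); last first.
  pose J : nat -> set (nat * nat) := fun i => [set (i, j) | j in setT].
  rewrite (_ : setT = \bigcup_k J k); last first.
    by rewrite predeqE => -[a b]; split => // _; exists a => //; exists b.
  rewrite esum_bigcupT /=; last 2 first.
    - apply/trivIsetP => i j _ _ ij.
      rewrite predeqE => -[n m] /=; split => //= -[] [_] _ [<-{n} _].
      by move=> [m' _] [] /esym/eqP; rewrite (negbTE ij).
    - by move=> /= [n m]; exact: hausdorff_gauge_ge0.
  rewrite -(image_id [set: nat]) -fun_true esum_pred_image//; last first.
    by move=> n _; apply: esum_ge0 => ? _; exact: muG_ge0.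
  apply: eq_eseriesr => /= j _.
  rewrite -(esum_pred_image (hausdorff_gauge \o uncurry G) (pair j) predT)//=; last first.
    by move=> ? ? _ _; exact: (@can_inj _ _ _ snd).
  - by move=> *; exact: hausdorff_gauge_ge0.
  by congr esum; rewrite predeqE => -[a b]; split; move=> [i _ <-]; exists i.
apply: lee_nneseries => n; last by move=> _; exact: (PG n).2.
by move=> _ _; apply: nneseries_ge0 => m _ _; exact: hausdorff_gauge_ge0.
Qed.

Lemma hausdorff_premeasure_le delta A : (0 < delta)%R ->
  hausdorff_premeasure delta A <= hausdorff_measure A.
Proof. by move=> d0; apply: ereal_sup_ubound; exists delta. Qed.

Lemma hausdorff_measure_ge0 A : 0 <= hausdorff_measure A.
Proof.
exact: le_trans (hausdorff_premeasure_ge0 1 A) (hausdorff_premeasure_le A ltr01).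
Qed.

Lemma hausdorff_measure0 : hausdorff_measure set0 = 0.
Proof.
apply/eqP; rewrite eq_le hausdorff_measure_ge0 andbT.
by apply: ge_ereal_sup => _ [e _ <-]; rewrite hausdorff_premeasure0.
Qed.

Lemma le_hausdorff_measure : {homo hausdorff_measure : A B / A `<=` B >-> A <= B}.
Proof.
move=> A B AB; apply: ge_ereal_sup => _ [e e0 <-].
by apply: le_trans (hausdorff_premeasure_le B e0); exact: le_hausdorff_premeasure.
Qed.

Lemma hausdorff_measure_sigma_subadditive : sigma_subadditive hausdorff_measure.
Proof.
move=> F; apply: ge_ereal_sup => _ [e e0 <-].
apply: le_trans (hausdorff_premeasure_sigma_subadditive e F) _.
apply: lee_nneseries => n; first by move=> _ _; exact: hausdorff_premeasure_ge0.
by move=> _; exact: hausdorff_premeasure_le.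
Qed.

HB.instance Definition _ := isOuterMeasure.Build R H hausdorff_measure
  hausdorff_measure0 hausdorff_measure_ge0 le_hausdorff_measure
  hausdorff_measure_sigma_subadditive.

Lemma hausdorff_measure_separated (A B : set H) (e : R) : (0 < e)%R ->
  (forall a b, A a -> B b -> (e <= mdist a b)%R) ->
  hausdorff_measure A + hausdorff_measure B <= hausdorff_measure (A `|` B).
Proof.
move=> e0 sep; set M := hausdorff_measure (A `|` B).
have key (d1 d2 : R) : (0 < d1)%R -> (0 < d2)%R ->
    hausdorff_premeasure d1 A + hausdorff_premeasure d2 B <= M.
  move=> d10 d20; pose dl : R := (Num.min (Num.min d1 d2) (e / 2))%R.
  have dl0 : (0 < dl)%R by rewrite !lt_min d10 d20 divr_gt0.
  apply: le_trans (hausdorff_premeasure_le _ dl0).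
  apply: (@le_trans _ _ (hausdorff_premeasure dl A + hausdorff_premeasure dl B)).
    by apply: leeD; apply: hausdorff_premeasure_anti; rewrite /dl !ge_min lexx ?orbT.
  apply: le_ereal_inf_tmp => _ [F [ABF Fd] <-].
  pose hit n := F n `&` A != set0.
  pose FA n := if hit n then F n else set0.
  pose FB n := if hit n then set0 else F n.
  have -> : \sum_(n <oo) hausdorff_gauge (F n) =
      \sum_(n <oo) hausdorff_gauge (FA n) + \sum_(n <oo) hausdorff_gauge (FB n).
    rewrite -nneseriesD; last 2 first.
      by move=> *; exact: hausdorff_gauge_ge0.
      by move=> *; exact: hausdorff_gauge_ge0.
    apply: eq_eseriesr => n _; rewrite /FA /FB.
    by case: ifP; rewrite hausdorff_gauge0 ?adde0 ?add0e.
  apply: leeD; apply: ereal_inf_lbound; [exists FA|exists FB] => //; split.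
  - move=> a Aa; have [|n _ Fna] := ABF a; first by left.
    exists n => //; rewrite /FA ifT //; apply/set0P; by exists a.
  - by move=> n; rewrite /FA; case: ifP => // _; rewrite ediam_set0 leNye.
  - move=> b Bb; have [|n _ Fnb] := ABF b; first by right.
    exists n => //; rewrite /FB ifF //; apply/negbTE/negP => /set0P[a [Fna Aa]].
    have : (mdist a b)%:E <= dl%:E.
      apply: le_trans (Fd n); apply: ereal_sup_ubound.
      by exists a => //; exists b.
    rewrite lee_fin => abd; have := sep a b Aa Bb.
    have : (dl <= e / 2)%R by rewrite /dl ge_min lexx orbT.
    by move: abd e0; lra.
  - by move=> n; rewrite /FB; case: ifP => // _; rewrite ediam_set0 leNye.
have [->|Moo] := eqVneq M +oo; first exact: leey.
have M0 : 0 <= M by exact: hausdorff_measure_ge0.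
have Mfin : M < +oo by rewrite ltey.
have BM : hausdorff_measure B <= M by apply: le_hausdorff_measure; exact: subsetUr.
have Bfin : hausdorff_measure B \is a fin_num.
  by rewrite ge0_fin_numE ?hausdorff_measure_ge0 // (le_lt_trans BM).
rewrite -leeBrDr //; apply: ge_ereal_sup => _ [d1 d10 <-].
have Afin : hausdorff_premeasure d1 A \is a fin_num.
  rewrite ge0_fin_numE ?hausdorff_premeasure_ge0 // (le_lt_trans _ Mfin) //.
  by apply: le_trans (key _ _ d10 d10); rewrite leeDl // hausdorff_premeasure_ge0.
rewrite leeBrDr // addeC -leeBrDr //; apply: ge_ereal_sup => _ [d2 d20 <-].
by rewrite leeBrDr // addeC; exact: key.
Qed.

Lemma hausdorff_measure_closed (C : set H) : closed C ->
  hausdorff_measure.-caratheodory C.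
Proof.
move=> cC; apply: le_caratheodory_measurable => X.
change (hausdorff_measure (X `&` C) + hausdorff_measure (X `&` ~` C) <=
        hausdorff_measure X).
have [->|Xoo] := eqVneq (hausdorff_measure X) +oo; first exact: leey.
have Xfin : hausdorff_measure X < +oo by rewrite ltey.
pose A n : set H := [set x | X x /\ forall c, C c -> (n.+1%:R^-1 <= mdist x c)%R].
have AX n : A n `<=` X by move=> x [].
have AS n : A n `<=` A n.+1.
  move=> x [Xx xC]; split=> // c Cc; rewrite (le_trans _ (xC c Cc)) //.
  by rewrite lef_pV2 ?posrE ?ltr0n // ler_nat.
pose r n := hausdorff_measure (A n.+1 `\` A n).
pose a n := hausdorff_measure (A n).
have r0 n : 0 <= r n by exact: hausdorff_measure_ge0.
have a0 n : 0 <= a n by exact: hausdorff_measure_ge0.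
have aX n : a n <= hausdorff_measure X by exact: le_hausdorff_measure.
have step n : a n + r n.+1 <= a n.+2.
  apply: (@le_trans _ _ (hausdorff_measure (A n `|` (A n.+2 `\` A n.+1)))).
    apply: (@hausdorff_measure_separated _ _ (n.+1%:R^-1 - n.+2%:R^-1)%R).
      by rewrite subr_gt0 ltf_pV2 ?posrE ?ltr0n // ltr_nat.
    move=> x y [_ xC] [[Xy _] nAy].
    have [c Cc yc] : exists2 c, C c & (mdist y c < n.+2%:R^-1)%R.
      apply: contrapT => h; apply: nAy; split=> // c Cc.
      by rewrite leNgt; apply/negP => yc; apply: h; exists c.
    have := xC c Cc; have := metric_triangle x y c; move: yc.
    set u := (n.+1%:R^-1)%R; set v := (n.+2%:R^-1)%R; lra.
  apply: le_hausdorff_measure => x [Anx|[]//]; exact/AS/AS.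
have sum_le n : \sum_(0 <= k < n.+1) r k <= a n.+1 + a n.
  elim: n => [|n ih].
    rewrite big_nat1; apply: (@le_trans _ _ (a 1%N)); last by rewrite leeDl.
    by apply: le_hausdorff_measure => x [].
  rewrite big_nat_recr //= (le_trans (leeD2r _ ih)) // -addeA.
  by rewrite [leRHS]addeC leeD2l.
have rfin : \sum_(0 <= k <oo) r k < +oo.
  apply: (@le_lt_trans _ _ (hausdorff_measure X + hausdorff_measure X)).
    apply: lime_le; first by apply: is_cvg_nneseries.
    near=> n; have n1 : (0 < n)%N by near: n; exists 1%N.
    by rewrite -(prednK n1) (le_trans (sum_le n.-1)) // leeD.
  by rewrite lte_add_pinfty.
have tail := nneseries_tail_cvg rfin (fun k _ => r0 k).
have cover n : hausdorff_measure (X `&` ~` C) <= a n + \sum_(n <= k <oo) r k.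
  pose U := \bigcup_(k in ~` `I_n) (A k.+1 `\` A k).
  have sub : X `&` ~` C `<=` A n `|` U.
    move=> x [Xx nCx].
    have [m Amx] : exists m, A m x.
      have : nbhs x (~` C) by apply: open_nbhs_nbhs; split=> //; exact: closed_openC.
      rewrite -nbhs_ballE => -[e /= e0 eC].
      exists (Num.truncn e^-1%R); split=> // c Cc; rewrite leNgt; apply/negP => xc.
      apply: (eC c) => //; rewrite ballEmdist /= (lt_trans xc) //.
      by rewrite invf_plt ?posrE ?ltr0n // truncnS_gt.
    pose Q m := `[< A m x >].
    have exQ : exists m, Q m by exists m; exact/asboolP.
    have := ex_minnP exQ => -[k /asboolP Akx kmin].
    have AA i j : (i <= j)%N -> A i x -> A j x.
      move=> /subnK <-; elim: (j - i)%N => // l IH /IH; rewrite addSn; exact: AS.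
    have [kn|] := leqP k n; first by left; exact: AA Akx.
    case: k Akx kmin => // k Akx kmin nk; right.
    exists k; first by apply/negP; rewrite -leqNgt.
    split=> // Akx'.
    have : Q k by exact/asboolP.
    by move/kmin; rewrite ltnn.
  apply: le_trans (le_hausdorff_measure sub) _.
  apply: le_trans (outer_measureU2 _ _ _) _; rewrite leeD2l //.
  exact: outer_measure_sigma_subadditive_tail.
apply/lee_addgt0Pr => e e0.
have [N _ tN] : \forall N \near \oo, \sum_(N <= k <oo) r k < e%:E.
  apply: (tail [set y | y < e%:E]); apply: open_nbhs_nbhs; split.
    exact: open_ereal_lt_ereal.
  by rewrite /= lte_fin.
have {}tN := tN N (leqnn N).
apply: (@le_trans _ _ (hausdorff_measure (X `&` C) + (a N + \sum_(N <= k <oo) r k))).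
  by rewrite leeD2l.
rewrite addeA; apply: leeD; last exact: ltW.
apply: (@le_trans _ _ (hausdorff_measure ((X `&` C) `|` A N))).
  apply: (@hausdorff_measure_separated _ _ (N.+1%:R^-1)%R) => //.
  by move=> x y [_ Cx] [_ yC]; rewrite metric_sym; exact: yC.
by apply: le_hausdorff_measure => x [[]//|]; exact: AX.
Unshelve. all: by end_near.
Qed.

Lemma hausdorff_measure_borel (A : set H) : measurable A ->
  hausdorff_measure.-caratheodory A.
Proof.
have sm := sigma_algebra_measurable (caratheodory_type hausdorff_measure).
apply: smallest_sub.
  split=> [|B mB|F mF].
  - exact: caratheodory_measurable_set0.
  - rewrite setTD; exact: caratheodory_measurable_setC.
  - exact: caratheodory_measurable_bigcup.
move=> U oU; rewrite -[U]setCK; apply: caratheodory_measurable_setC.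
exact/hausdorff_measure_closed/open_closedC.
Qed.

Lemma hausdorff_measure_sigma_additive :
  semi_sigma_additive (hausdorff_measure : set H -> \bar R).
Proof.
move=> F mF tF mUF.
by apply: (@caratheodory_measure_sigma_additive R H hausdorff_measure) => // [n|];
  exact: hausdorff_measure_borel.
Qed.

HB.instance Definition _ := isMeasure.Build _ _ _ hausdorff_measure
  hausdorff_measure0 hausdorff_measure_ge0 hausdorff_measure_sigma_additive.

End hausdorff_measure.

Section hisometry_group.
Context (R : realType) (d : nat).
Local Notation H := (hyperbolic R d).

Record hisometry := HIsometry {
  ifun :> H -> H;
  ifunP : (forall x y, mdist (ifun x) (ifun y) = mdist x y) /\
          (forall y, exists x, ifun x = y) }.

Lemma hisometry_eq (f g : hisometry) : ifun f =1 ifun g -> f = g.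
Proof.
case: f g => [f fP] [g gP] /= /funext fg; subst g.
by congr HIsometry; exact: Prop_irrelevance.
Qed.

HB.instance Definition _ := gen_eqMixin hisometry.
HB.instance Definition _ := gen_choiceMixin hisometry.

Lemma hisometry_inj (f : hisometry) : injective f.
Proof.
move=> x y fxy; apply: (@mdist_positivity R H).
by rewrite -(ifunP f).1 fxy mdistxx.
Qed.

Definition hisometry_one : hisometry :=
  @HIsometry id (conj (fun _ _ => erefl) (fun y => ex_intro _ y erefl)).

Lemma hisometry_mul_subproof (f g : hisometry) :
  (forall x y, mdist ((f \o g) x) ((f \o g) y) = mdist x y) /\
  (forall y, exists x, (f \o g) x = y).
Proof.
split=> [x y /=|z]; first by rewrite !(ifunP _).1.
have [y fy] := (ifunP f).2 z; have [x gx] := (ifunP g).2 y.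
by exists x; rewrite /= gx.
Qed.

Definition hisometry_mul f g : hisometry := HIsometry (hisometry_mul_subproof f g).

Definition hisometry_inv_fun (f : hisometry) (y : H) : H :=
  sval (cid ((ifunP f).2 y)).

Lemma hisometry_inv_funK (f : hisometry) : cancel (hisometry_inv_fun f) f.
Proof. by move=> y; rewrite /hisometry_inv_fun; case: cid. Qed.

Lemma hisometry_inv_subproof (f : hisometry) :
  (forall x y, mdist (hisometry_inv_fun f x) (hisometry_inv_fun f y) = mdist x y) /\
  (forall y, exists x, hisometry_inv_fun f x = y).
Proof.
split=> [x y|y]; first by rewrite -(ifunP f).1 !hisometry_inv_funK.
by exists (f y); apply: (@hisometry_inj f); rewrite hisometry_inv_funK.
Qed.

Definition hisometry_inv f : hisometry := HIsometry (hisometry_inv_subproof f).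

Lemma hisometry_mulA : associative hisometry_mul.
Proof. by move=> f g h; exact: hisometry_eq. Qed.
Lemma hisometry_mul1 : left_id hisometry_one hisometry_mul.
Proof. by move=> f; exact: hisometry_eq. Qed.
Lemma hisometry_mulr1 : right_id hisometry_one hisometry_mul.
Proof. by move=> f; exact: hisometry_eq. Qed.
Lemma hisometry_mulV : left_inverse hisometry_one hisometry_inv hisometry_mul.
Proof.
move=> f; apply: hisometry_eq => x; apply: (@hisometry_inj f) => /=.
by rewrite hisometry_inv_funK.
Qed.
Lemma hisometry_mulrV : right_inverse hisometry_one hisometry_inv hisometry_mul.
Proof. by move=> f; apply: hisometry_eq => x /=; rewrite hisometry_inv_funK. Qed.

HB.instance Definition _ := @isGroup.Build hisometry hisometry_one hisometry_inv
  hisometry_mul hisometry_mulA hisometry_mul1 hisometry_mulr1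
  hisometry_mulV hisometry_mulrV.

HB.instance Definition _ := isPointed.Build hisometry hisometry_one.

HB.instance Definition _ := Topological.copy hisometry
  (initial_topology (ifun : hisometry -> {compact-open, H -> H})).

HB.instance Definition _ := Measurable.copy hisometry
  (g_sigma_algebraType (@open hisometry)).

Lemma hisometry_continuous (f : hisometry) : continuous f.
Proof.
apply/continuousP => A oA; rewrite openE => x /= Afx.
have : nbhs (f x) A by exact: open_nbhs_nbhs.
rewrite -nbhs_ballE => -[e /= e0 eA]; apply/nbhs_ballP; exists e => //= y.
rewrite ballEmdist /= => xy; apply: eA; rewrite ballEmdist /=.
by rewrite (ifunP f).1.
Qed.

Lemma hisometry_mul_continuous (f : hisometry) :
  continuous (fun g : hisometry => (f * g)%g).
Proof.
suff c : continuous (fun g : hisometry =>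
    ((f * g)%g : hisometry) : {compact-open, H -> H}).
  by move/continuousP in c; apply/continuousP => _ [B oB <-]; exact: (c B oB).
move=> g.
have /compact_open_cvgP cvg_fg := fmap_filter
  (fun h : hisometry => ((f * h)%g : hisometry) : {compact-open, H -> H})
  (nbhs_filter g).
apply/cvg_fg => K O cK oO /= fgO.
have oO' : open (f @^-1` O).
  by apply: open_comp => // x _; exact: hisometry_continuous.
have gO : (g : H -> H) @` K `<=` f @^-1` O.
  by move=> _ [x Kx <-]; apply: fgO; exists x.
have oK := @compact_open_open H H K _ cK oO'.
have N := @initial_continuous hisometry _
  (ifun : hisometry -> {compact-open, H -> H}) g _ (open_nbhs_nbhs (conj oK gO)).
apply: (@filterS _ (nbhs g) (nbhs_filter g) _ _ _ N) => h /= hO _ [x Kx <-] /=.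
have : (f @^-1` O) (h x) by apply: hO; exists x.
by [].
Qed.

Lemma hisometry_mul_measurable (f : hisometry) :
  measurable_fun setT (fun g : hisometry => (f * g)%g).
Proof.
apply: (measurability (@open hisometry)) => // _ [A oA <-].
rewrite setTI; apply: sub_sigma_algebra.
by apply: open_comp => // x _; exact: hisometry_mul_continuous.
Qed.

End hisometry_group.

Section compact_sets.
Context (R : realType) (d : nat).
Local Notation H := (hyperbolic R d).
Local Notation I := (hisometry R d).

Record compacts := Compacts {
  cset :> set H;
  csetP : compact cset /\ cset !=set0 }.

Lemma compacts_eq (K L : compacts) : cset K = cset L -> K = L.
Proof.
case: K L => [K KP] [L LP] /= KL; subst L.
by congr Compacts; exact: Prop_irrelevance.
Qed.

HB.instance Definition _ := gen_eqMixin compacts.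
HB.instance Definition _ := gen_choiceMixin compacts.

(* Each of the two sets lies in the closed [e]-neighbourhood of the other; the
   Hausdorff distance of compact sets is the infimum of such [e]. *)
Definition hausdorff_bound (A B : set H) (e : R) : Prop :=
  [/\ 0 <= e, (forall x, A x -> exists2 y, B y & mdist x y <= e)
    & (forall y, B y -> exists2 x, A x & mdist x y <= e)].

Definition hausdorff_dist (K L : compacts) : R :=
  inf [set e | hausdorff_bound K L e].

Lemma compact_mdist_bounded (K : set H) (x : H) : compact K ->
  exists2 M, 0 <= M & forall y, K y -> mdist x y <= M.
Proof.
rewrite compact_cover => Kco.
have cov : K `<=` \bigcup_(n : nat) ball x n%:R.
  move=> y _; exists (Num.truncn (mdist x y)).+1 => //.
  by rewrite ballEmdist /= truncnS_gt.
have [|D _ DK] := Kco _ _ _ _ cov.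
  move=> n _; rewrite openE => y; rewrite ballEmdist /= => xy.
  apply/nbhs_ballP; exists (n%:R - mdist x y); first by rewrite /= subr_gt0.
  move=> z; rewrite ballEmdist /= => yz.
  by apply: le_lt_trans (metric_triangle x y z) _; rewrite -ltrBrDl.
exists (\big[Num.max/0]_(i : D) (fsval i)%:R).
  exact: bigmax_ge_id.
move=> y /DK[n /= nD]; rewrite ballEmdist /= => /ltW xy.
apply: le_trans xy _.
have : n \in enum_fset D by [].
rewrite enum_fsetE => /mapP[/= i _ ->].
exact: (le_bigmax _ (fun i : D => (fsval i)%:R : R)).
Qed.

Lemma hausdorff_bound_nonempty (K L : compacts) :
  [set e | hausdorff_bound K L e] !=set0.
Proof.
have [[cK [x Kx]] [cL [y Ly]]] := (csetP K, csetP L).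
have [M M0 xL] := compact_mdist_bounded x cL.
have [N N0 yK] := compact_mdist_bounded y cK.
exists (M + N); split=> [|z Kz|z Lz]; first exact: addr_ge0.
- by exists y => //; rewrite metric_sym (le_trans (yK z Kz)) // lerDr.
- by exists x => //; rewrite (le_trans (xL z Lz)) // lerDl.
Qed.

Lemma hausdorff_bound_has_inf (K L : compacts) :
  has_inf [set e | hausdorff_bound K L e].
Proof.
by split; [exact: hausdorff_bound_nonempty | exists 0 => e []].
Qed.

Lemma hausdorff_dist_ge0 (K L : compacts) : 0 <= hausdorff_dist K L.
Proof. by apply: lb_le_inf; [exact: hausdorff_bound_nonempty | move=> e []]. Qed.

Lemma hausdorff_dist_le (K L : compacts) e :
  hausdorff_bound K L e -> hausdorff_dist K L <= e.
Proof. by move=> h; apply: ge_inf => //; case: (hausdorff_bound_has_inf K L). Qed.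

Lemma hausdorff_dist_lt (K L : compacts) e : 0 < e ->
  exists2 r, hausdorff_bound K L r & r < hausdorff_dist K L + e.
Proof. by move=> e0; exact: (inf_adherent e0 (hausdorff_bound_has_inf K L)). Qed.

Lemma hausdorff_distxx (K : compacts) : hausdorff_dist K K = 0.
Proof.
apply/eqP; rewrite eq_le hausdorff_dist_ge0 andbT.
by apply: hausdorff_dist_le; split=> // x Kx; exists x => //; rewrite mdistxx.
Qed.

Lemma hausdorff_dist_sym (K L : compacts) :
  hausdorff_dist K L = hausdorff_dist L K.
Proof.
rewrite /hausdorff_dist; congr inf; apply/seteqP; split=> e [e0 h1 h2];
  split=> // x hx; [have [y ? ?] := h2 _ hx|have [y ? ?] := h1 _ hx|
    have [y ? ?] := h2 _ hx|have [y ? ?] := h1 _ hx];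
  by exists y => //; rewrite metric_sym.
Qed.

Lemma hausdorff_dist_triangle (L K M : compacts) :
  hausdorff_dist K M <= hausdorff_dist K L + hausdorff_dist L M.
Proof.
apply/ler_addgt0Pl => e e0.
have e20 : 0 < e / 2 by rewrite divr_gt0.
have [r [r0 KL LK] re] := hausdorff_dist_lt K L e20.
have [s [s0 LM ML] se] := hausdorff_dist_lt L M e20.
apply: (@le_trans _ _ (r + s)); last by rewrite (splitr e) addrACA addrC -!addrA; lra.
apply: hausdorff_dist_le; split=> [|x Kx|z Mz]; first exact: addr_ge0.
- have [y Ly xy] := KL x Kx; have [z Mz yz] := LM y Ly.
  by exists z => //; rewrite (le_trans (metric_triangle x y z)) // lerD.
- have [y Ly yz] := ML z Mz; have [x Kx xy] := LK y Ly.
  by exists x => //; rewrite (le_trans (metric_triangle x y z)) // lerD.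
Qed.

Lemma hausdorff_dist_positivity (K L : compacts) :
  hausdorff_dist K L = 0 -> K = L.
Proof.
suff sub (A B : compacts) : hausdorff_dist A B = 0 -> cset A `<=` cset B.
  move=> KL; apply: compacts_eq; apply/seteqP; split; apply: sub => //.
  by rewrite hausdorff_dist_sym.
move=> AB x Ax.
have /closure_id -> : closed (cset B).
  by apply: compact_closed; [exact: metric_hausdorff | case: (csetP B)].
move=> U; rewrite -nbhs_ballE => -[e /= e0 eU].
have [r [_ h _]] := hausdorff_dist_lt A B e0; rewrite AB add0r => re.
have [y By xy] := h x Ax; exists y; split=> //; apply: eU.
by rewrite ballEmdist /= (le_lt_trans xy).
Qed.

HB.instance Definition _ := @isMetric.Build R compacts hausdorff_dist
  hausdorff_distxx hausdorff_dist_positivity hausdorff_dist_sym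
  hausdorff_dist_triangle.

Definition compacts_point : compacts :=
  Compacts (conj (@compact_set1 H point) (ex_intro _ point erefl)).

HB.instance Definition _ := isPointed.Build compacts compacts_point.

HB.instance Definition _ := Measurable.copy compacts
  (g_sigma_algebraType (@open compacts)).

Lemma hisometry_image_subproof (f : I) (K : compacts) :
  compact (f @` K) /\ (f @` K) !=set0.
Proof.
have [cK [x Kx]] := csetP K; split; last by exists (f x), x.
apply: continuous_compact => //.
by apply: continuous_subspaceT => x0; exact: hisometry_continuous.
Qed.

Definition hisometry_act (f : I) (K : compacts) : compacts :=
  Compacts (hisometry_image_subproof f K).

Lemma hisometry_act_dist (f : I) (K L : compacts) :
  hausdorff_dist (hisometry_act f K) (hisometry_act f L) = hausdorff_dist K L.
Proof.
rewrite /hausdorff_dist; congr inf; apply/seteqP; split=> e [e0 h1 h2]; split=> //.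
- move=> x Kx; have [|_ [y Ly <-]] := h1 (f x); first by exists x.
  by rewrite (ifunP f).1; exists y.
- move=> x Kx; have [|_ [y Ly <-]] := h2 (f x); first by exists x.
  by rewrite (ifunP f).1; exists y.
- move=> _ [x Kx <-]; have [y Ly xy] := h1 x Kx.
  by exists (f y); [exists y|rewrite (ifunP f).1].
- move=> _ [x Kx <-]; have [y Ly xy] := h2 x Kx.
  by exists (f y); [exists y|rewrite (ifunP f).1].
Qed.

Lemma hisometry_act_continuous (f : I) : continuous (hisometry_act f).
Proof.
apply/continuousP => A oA; rewrite openE => K /= AK.
have : nbhs (hisometry_act f K) A by exact: open_nbhs_nbhs.
rewrite -nbhs_ballE => -[e /= e0 eA]; apply/nbhs_ballP; exists e => //= L.
have E : mdist (hisometry_act f K) (hisometry_act f L) = mdist K L :=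
  hisometry_act_dist f K L.
by rewrite ballEmdist /= -E => KL; apply: eA; rewrite ballEmdist.
Qed.

Lemma hisometry_act_measurable (f : I) : measurable_fun setT (hisometry_act f).
Proof.
apply: (measurability (@open compacts)) => // _ [A oA <-].
rewrite setTI; apply: sub_sigma_algebra.
by apply: open_comp => // x _; exact: hisometry_act_continuous.
Qed.

End compact_sets.

Section point_measures.
Context (R : realType) (d : nat).
Local Notation I := (hisometry R d).
Local Notation C := (compacts R d).
Local Open Scope ereal_scope.

(* Countable sums of finite measures with values in the natural numbers. All
   conditions bear on Borel sets only, as a [measure] takes arbitrary values
   elsewhere. *)
Record pointMeasure := PointMeasure {
  pmeasure :> {measure set C -> \bar R};
  pmeasureP : exists mu : nat -> {measure set C -> \bar R},
    (forall n A, measurable A -> exists k : nat, mu n A = k%:R%:E) /\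
    (forall A, measurable A -> pmeasure A = \sum_(n <oo) mu n A) }.

HB.instance Definition _ := gen_eqMixin pointMeasure.
HB.instance Definition _ := gen_choiceMixin pointMeasure.

Lemma pmeasure0_subproof : exists mu : nat -> {measure set C -> \bar R},
    (forall n A, measurable A -> exists k : nat, mu n A = k%:R%:E) /\
    (forall A, measurable A -> (mzero A : \bar R) = \sum_(n <oo) mu n A).
Proof.
exists (fun=> mzero); split=> [n A _|A _]; first by exists 0%N.
by rewrite eseries0.
Qed.

HB.instance Definition _ :=
  isPointed.Build pointMeasure (PointMeasure pmeasure0_subproof).

Definition evaluation_sets : set (set pointMeasure) :=
  \bigcup_(A in [set A : set C | measurable A])
    preimage_set_system setT (fun m : pointMeasure => m A) measurable.

HB.instance Definition _ := Measurable.copy pointMeasure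
  (g_sigma_algebraType evaluation_sets).

Lemma evaluation_measurable (A : set C) : measurable A ->
  measurable_fun setT (fun m : pointMeasure => m A).
Proof.
move=> mA _ B mB; apply: sub_sigma_algebra; exists A => //.
by exists B.
Qed.

Section pushforward.
Variables (f : I) (mu : {measure set C -> \bar R}).

Definition push_measure (A : set C) : \bar R := mu (hisometry_act f @^-1` A).

Let push0 : push_measure set0 = 0.
Proof. by rewrite /push_measure preimage_set0 measure0. Qed.

Let push_ge0 A : 0 <= push_measure A.
Proof. exact: measure_ge0. Qed.

Let push_additive : semi_sigma_additive push_measure.
Proof.
have mf (A : set C) : measurable A -> measurable (hisometry_act f @^-1` A).
  by move=> mA; rewrite -[X in measurable X]setTI; exact: hisometry_act_measurable.
move=> F mF tF mUF; rewrite /push_measure preimage_bigcup.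
apply: measure_semi_sigma_additive.
- by move=> n; exact: mf.
- apply/trivIsetP => /= i j _ _ ij; rewrite -preimage_setI.
  by move/trivIsetP : tF => /(_ _ _ _ _ ij) ->//; rewrite preimage_set0.
- by rewrite -preimage_bigcup; exact: mf.
Qed.

HB.instance Definition _ := isMeasure.Build _ _ _ push_measure
  push0 push_ge0 push_additive.

End pushforward.

Lemma pmeasure_act_subproof (f : I) (m : pointMeasure) :
  exists mu : nat -> {measure set C -> \bar R},
    (forall n A, measurable A -> exists k : nat, mu n A = k%:R%:E) /\
    (forall A, measurable A -> push_measure f m A = \sum_(n <oo) mu n A).
Proof.
have [mu [muN muE]] := pmeasureP m.
have mf (A : set C) : measurable A -> measurable (hisometry_act f @^-1` A).
  by move=> mA; rewrite -[X in measurable X]setTI; exact: hisometry_act_measurable.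
exists (fun n => push_measure f (mu n)); split => [n A mA|A mA].
  by apply: muN; exact: mf.
by rewrite /= /push_measure muE //; exact: mf.
Qed.

Definition pmeasure_act (f : I) (m : pointMeasure) : pointMeasure :=
  PointMeasure (pmeasure_act_subproof f m).

End point_measures.

Section particle_processes.
Context (R : realType) (d : nat).
Local Notation H := (hyperbolic R d).
Local Notation I := (hisometry R d).
Local Notation C := (compacts R d).
Context (disp : measure_display) (Omega : measurableType disp).
Context (P : probability Omega R).
Local Open Scope ereal_scope.

Definition hitting_set (A : set H) : set C := [set K | cset K `&` A !=set0].

Definition particle_process (zeta : {mfun Omega >-> pointMeasure R d}) : Prop :=
  forall A : set H, compact A -> {ae P, forall w, zeta w (hitting_set A) < +oo}.

Definition stationary (zeta : {mfun Omega >-> pointMeasure R d}) : Prop :=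
  forall (f : I) (E : set (pointMeasure R d)), measurable E ->
    P [set w | E (pmeasure_act f (zeta w))] = P [set w | E (zeta w)].

Section intensity.
Variable zeta : {mfun Omega >-> pointMeasure R d}.

Definition intensity_measure (A : set C) : \bar R := \int[P]_w zeta w A.

Let intensity0 : intensity_measure set0 = 0.
Proof. by rewrite /intensity_measure integral0_eq // => w _; rewrite measure0. Qed.

Let intensity_ge0 A : 0 <= intensity_measure A.
Proof. by apply: integral_ge0 => w _; exact: measure_ge0. Qed.

Let intensity_additive : semi_sigma_additive intensity_measure.
Proof.
move=> F mF tF mUF; rewrite /intensity_measure.
rewrite (_ : (fun n => _) = (fun n => \sum_(0 <= i < n) \int[P]_w zeta w (F i))) //.
under eq_integral do rewrite measure_semi_bigcup //.
rewrite integral_nneseries //.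
- by apply: is_cvg_nneseries => n _ _; exact: integral_ge0.
- move=> n.
  by apply: (measurableT_comp (evaluation_measurable (mF n))).
Qed.

HB.instance Definition _ := isMeasure.Build _ _ _ intensity_measure
  intensity0 intensity_ge0 intensity_additive.

End intensity.
End particle_processes.

Section invariant_measures.
Context (R : realType) (d : nat).
Local Notation H := (hyperbolic R d).
Local Notation I := (hisometry R d).
Local Notation C := (compacts R d).
Local Open Scope ereal_scope.

Definition isotropy (p : H) : set I := [set f | f p = p].

Lemma isotropy_measurable p : measurable (isotropy p).
Proof.
rewrite -[X in measurable X]setCK; apply: measurableC; apply: sub_sigma_algebra.
have cp : closed [set p].
  by apply: compact_closed; [exact: metric_hausdorff|exact: compact_set1].
exists [set h : {compact-open, H -> H} | h @` [set p] `<=` ~` [set p]].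
  by apply: compact_open_open; [exact: compact_set1|exact: closed_openC].
apply/seteqP; split=> f /=; first by move=> h fp; apply: (h (f p)) => //=; exists p.
by move=> h _ [_ -> <-].
Qed.

Section kappa.
Variables (p : H) (kp : {measure set I -> \bar R}) (s : H -> I) (x : H).

(* [s x] is the chosen isometry mapping [p] to [x], and [kp] the invariant
   probability measure on the isotropy group of [p]. *)
Definition kappa (A : set I) : \bar R :=
  \int[kp]_(f in isotropy p) (\1_A (s x * f)%g)%:E.

Lemma kappaE A : measurable A ->
  kappa A = kp ((fun f => (s x * f)%g) @^-1` A `&` isotropy p).
Proof.
move=> mA; have mp := isotropy_measurable p.
rewrite -integral_indic //.
by rewrite -[X in measurable X]setTI; exact: hisometry_mul_measurable.
Qed.

Let kappa0 : kappa set0 = 0.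
Proof. by rewrite kappaE // preimage_set0 set0I measure0. Qed.

Let kappa_ge0 A : 0 <= kappa A.
Proof. by apply: integral_ge0 => f _; rewrite lee_fin. Qed.

Let kappa_additive : semi_sigma_additive kappa.
Proof.
have mf (A : set I) : measurable A -> measurable
    ((fun f => (s x * f)%g) @^-1` A `&` isotropy p).
  move=> mA; apply: measurableI; last exact: isotropy_measurable.
  by rewrite -[X in measurable X]setTI; exact: hisometry_mul_measurable.
move=> F mF tF mUF; rewrite kappaE // preimage_bigcup setI_bigcupl.
under eq_fun do under eq_bigr do rewrite kappaE //.
apply: measure_semi_sigma_additive.
- by move=> n; exact: mf.
- apply/trivIsetP => /= i j _ _ ij; rewrite setIACA -preimage_setI.
  by move/trivIsetP : tF => /(_ _ _ _ _ ij) ->//; rewrite preimage_set0 set0I.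
- by rewrite -setI_bigcupl -preimage_bigcup; exact: mf.
Qed.

HB.instance Definition _ := isMeasure.Build _ _ _ kappa
  kappa0 kappa_ge0 kappa_additive.
End kappa.

Definition normalized_haar (lam : {measure set I -> \bar R}) : Prop :=
  [/\ forall (f : I) (A : set I), measurable A -> lam [set g : I | A (f * g)%g] = lam A,
      forall (f : I) (A : set I), measurable A -> lam [set g : I | A (g * f)%g] = lam A,
      forall A : set I, measurable A -> lam [set g : I | A (g^-1)%g] = lam A,
      forall K : set I, compact K -> lam K < +oo &
      forall (x : H) (A : set H), measurable A ->
        hausdorff_measure A = \int[lam]_f (\1_A (f x))%:E].

(* The Haar probability measure of the isotropy group of [p], extended by 0 to
   the whole isometry group. *)
Definition isotropy_haar (p : H) (kp : probability I R) : Prop :=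
  [/\ kp (isotropy p) = 1,
      forall (f : I) (A : set I), isotropy p f -> measurable A ->
        kp [set g : I | A (f * g)%g] = kp A &
      forall (f : I) (A : set I), isotropy p f -> measurable A ->
        kp [set g : I | A (g * f)%g] = kp A].

Definition center_function (c : C -> H) : Prop :=
  measurable_fun setT c /\ forall (f : I) (K : C), c (hisometry_act f K) = f (c K).

Definition hball (x : H) (r : R) : set H := [set y | (mdist x y <= r)%R].

Definition typical_particle_law (p : H) (c : C -> H)
    (lam : {measure set I -> \bar R}) (Lambda : {measure set C -> \bar R})
    (gamma : R) (Q : probability C R) : Prop :=
  [/\ Q [set K | c K = p] = 1,
      forall (f : I) (A : set C), isotropy p f -> measurable A ->
        Q (hisometry_act f @^-1` A) = Q A &
      forall A : set C, measurable A ->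
        Lambda A = gamma%:E *
          \int[Q]_K \int[lam]_f (\1_A (hisometry_act f K))%:E].

End invariant_measures.

(* Main.v *)
(* Let t_x be the point reflection through the midpoint of p and x; it swaps p
   and x and depends measurably on x, so every particle K can be recentered to
   t_(c K) K, measurably in K. With B a ball of volume 1, let Q be the law of
   f^-1 t_(c K) K for f distributed by the Haar measure of the isotropy group and
   K by gamma^-1 Lambda restricted to {c K \in B}. Tonelli's theorem, the
   invariance of Lambda (from stationarity) and of lambda, and
   lambda {f | f^-1 x \in B} = 1 give the disintegration of Lambda. Conversely,
   if Q' disintegrates Lambda, substituting this disintegration in the formula
   for Q' and using that Q' is concentrated on {c K = p} and isotropy invariant
   gives the formula for every weight w, hence uniqueness. The joint
   measurability of the action needed for Tonelli rests on the separability of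
   the space of compact sets. *)
Require Import Defs.
From HB Require Import structures.
From mathcomp Require Import all_boot all_order all_algebra.
From mathcomp Require Import all_classical all_reals all_analysis measurable_realfun.
From mathcomp Require Import ring lra.

Set Implicit Arguments.
Unset Strict Implicit.
Unset Printing Implicit Defensive.

Import Order.TTheory GRing.Theory Num.Theory.
Import numFieldTopology.Exports numFieldNormedType.Exports.

Local Open Scope classical_set_scope.
Local Open Scope ring_scope.

(** * Hyperbolic geometry *)

Section hyperbolic_geometry.
Context (R : realType) (d : nat).
Local Notation H := (hyperbolic R d).

(** The right-hand side is minus the hyperbolic cosine of the distance. Inverting [arcosh] rests on
    [t ^+ 2 - u ^+ 2 = 1], which makes [t - u] the inverse of [t + u]. *)
Lemma lorentz_mdist (x y : H) :
  lorentz x y = - ((expR (mdist x y) + expR (- mdist x y)) / 2).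
Proof.
have := hcosh_ge1 x y; change (mdist x y) with (arcosh (- lorentz x y)).
rewrite /arcosh; set t := - lorentz x y => t1.
have -> : lorentz x y = - t by rewrite opprK.
congr (- _); set u := Num.sqrt _.
have u2 : u ^+ 2 = t ^+ 2 - 1 by rewrite sqr_sqrtr // subr_ge0 exprn_ege1.
have tu0 : 0 < t + u by rewrite ltr_wpDr ?sqrtr_ge0 //; lra.
rewrite expRN lnK ?posrE //.
have -> : (t + u)^-1 = t - u.
  apply: (mulfI (lt0r_neq0 tu0)); rewrite divff ?lt0r_neq0 //.
  by transitivity (t ^+ 2 - u ^+ 2); [rewrite u2; ring | ring].
by field.
Qed.

Lemma expR_sub_expRN_ge (a : R) : 0 <= a -> a <= expR a - expR (- a).
Proof.
move=> a0; have := expR_ge1Dx a; have : expR (- a) <= 1.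
  by rewrite -expR0 ler_expR oppr_le0.
by move=> h1 h2; lra.
Qed.

(** With [D] the distance, the Lorentz square of [x - y] is [2 (cosh D - 1) = (u - v) ^+ 2], where
    [u] and [v] are the exponentials of [D / 2] and [- D / 2]. It is at least [(D / 2) ^+ 2], and at
    most the sum on the right, since the time coordinate contributes negatively. *)
Lemma mdist_sqr_le (x y : H) :
  mdist x y ^+ 2 <= 4 * \sum_(i < d) (hval x 0 (lift 0 i) - hval y 0 (lift 0 i)) ^+ 2.
Proof.
have xy : - lorentz x y - 1 <=
    (\sum_(i < d) (hval x 0 (lift 0 i) - hval y 0 (lift 0 i)) ^+ 2) / 2.
  have : lorentz (1 *: (x : 'rV_ _) - 1 *: (y : 'rV_ _))
            (1 *: (x : 'rV_ _) - 1 *: (y : 'rV_ _)) <=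
      \sum_(i < d) (hval x 0 (lift 0 i) - hval y 0 (lift 0 i)) ^+ 2.
    rewrite {1}/lorentz.
    under eq_bigr do rewrite !scale1r !mxE -expr2.
    by rewrite gerDr oppr_le0 -expr2 sqr_ge0.
  rewrite !lorentzBr !lorentzBl [lorentz y x]lorentzC !hyperbolic_lorentz; lra.
have := lorentz_mdist x y; set D := mdist x y => lE.
have D0 : 0 <= D / 2 by rewrite divr_ge0 // mdist_ge0.
have := expR_sub_expRN_ge D0; set u := expR (D / 2); set v := expR (- (D / 2)) => uv.
have uv1 : u * v = 1 by rewrite /u /v expRN divff // expR_eq0.
have uu : expR D = u ^+ 2 by rewrite expr2 -expRD -splitr.
have vv : expR (- D) = v ^+ 2 by rewrite expr2 -expRD -opprD -splitr.
have D2 : (D / 2) ^+ 2 <= (u - v) ^+ 2.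
  by rewrite ler_pXn2r ?nnegrE // (le_trans D0).
have : (u - v) ^+ 2 = u ^+ 2 + v ^+ 2 - 2 * (u * v) by ring.
rewrite uv1.
move: D2 xy; rewrite lE uu vv.
have -> : (D / 2) ^+ 2 = D ^+ 2 / 4 by field.
set S := \sum_(i < d) _; set U := u ^+ 2; set V := v ^+ 2; set W := D ^+ 2; lra.
Qed.

(** The upper sheet is a graph over the spatial coordinates [v]. *)
Definition hpoint_vec (v : 'I_d -> R) : 'rV[R]_d.+1 :=
  \row_j if unlift 0 j is Some i then v i else Num.sqrt (1 + \sum_(i < d) v i ^+ 2).

Lemma hpoint_subproof (v : 'I_d -> R) :
  (lorentz (hpoint_vec v) (hpoint_vec v) == -1) && (0 < hpoint_vec v 0 0).
Proof.
have S0 : 0 <= \sum_(i < d) v i ^+ 2 by apply: sumr_ge0 => i _; exact: sqr_ge0.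
rewrite /lorentz /hpoint_vec !mxE unlift_none sqrtr_gt0 ltr_pwDl // andbT.
rewrite -expr2 sqr_sqrtr ?addr_ge0 // opprD -addrA.
under [X in _ + (_ + X)]eq_bigr do rewrite !mxE liftK -expr2.
by rewrite addNr addr0.
Qed.

Definition hpoint v : H := Hyperbolic (hpoint_subproof v).

Definition hrat (q : {ffun 'I_d -> rat}) : H := hpoint (fun i => ratr (q i)).

Lemma hrat_dense (x : H) (e : R) : 0 < e -> exists q, mdist x (hrat q) < e.
Proof.
(* An error of at most [r] in each spatial coordinate bounds the squared distance by
   [4 d r ^+ 2 = e ^+ 2 * d / d.+1 ^+ 2], which is below [e ^+ 2]. *)
move=> e0; pose r : R := e / (2 * d.+1%:R).
have r0 : 0 < r by rewrite divr_gt0 // mulr_gt0 // ltr0n.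
have qP i : {q : rat | hval x 0 (lift 0 i) - r < ratr q < hval x 0 (lift 0 i)}.
  apply: cid; have [|q] := @rat_in_itvoo R (hval x 0 (lift 0 i) - r) (hval x 0 (lift 0 i)).
    by rewrite gtrBl.
  by rewrite in_itv; exists q.
exists [ffun i => sval (qP i)].
rewrite -(ltr_pXn2r (n := 2)) ?nnegrE ?mdist_ge0 ?(ltW e0) //.
apply: le_lt_trans (mdist_sqr_le _ _) _.
apply: (@le_lt_trans _ _ (4 * \sum_(i < d) r ^+ 2)).
  rewrite ler_pM2l //; apply: ler_sum => i _ /=.
  rewrite /hpoint_vec mxE liftK ffunE; case: (qP i) => q /= /andP[q1 q2].
  by rewrite ler_pXn2r ?nnegrE ?(ltW r0) //; lra.
rewrite sumr_const card_ord -[X in 4 * X]mulr_natr /r.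
have D1 : (d%:R : R) < d.+1%:R by rewrite ltr_nat.
have D0 : (0 : R) < d.+1%:R by rewrite ltr0n.
set D := (d.+1%:R : R) in D1 D0 *; set k := (d%:R : R) in D1 *.
have -> : 4 * ((e / (2 * D)) ^+ 2 * k) = e ^+ 2 * (k / D ^+ 2).
  by field; rewrite lt0r_neq0.
rewrite gtr_pMr ?exprn_gt0 // ltr_pdivrMr ?exprn_gt0 // mul1r.
apply: (lt_le_trans D1); rewrite expr2 ler_peMr ?(ltW D0) //.
by rewrite /D ler1n.
Qed.

(** * Point reflections of the hyperboloid *)

Section point_reflection.
Variables p x : H.

Let n : 'rV[R]_d.+1 := 1 *: (x : 'rV_ _) - (-1) *: (p : 'rV_ _).

Let m1_neq0 : lorentz x p - 1 != 0.
Proof. by have := hcosh_ge1 x p => h; apply: ltr0_neq0; lra. Qed.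

(** With [n = x + p] this is [2 <y, n> / <n, n> n - y]: the linear map fixing the direction [n] of
    the midpoint and acting as -1 on its Lorentz complement. Here [<n, n> = 2 (<x, p> - 1)], which
    is nonzero. *)
Definition point_reflection_vec (y : 'rV[R]_d.+1) : 'rV[R]_d.+1 :=
  ((lorentz y x + lorentz y p) / (lorentz x p - 1)) *: n - 1 *: y.

Lemma lorentz_point_reflection_vec (y z : 'rV[R]_d.+1) :
  lorentz (point_reflection_vec y) (point_reflection_vec z) = lorentz y z.
Proof.
rewrite /point_reflection_vec /n !(lorentzBl, lorentzBr) !hyperbolic_lorentz.
by rewrite [lorentz p x]lorentzC [lorentz x z]lorentzC [lorentz p z]lorentzC; field.
Qed.

Lemma point_reflection_vec_base : point_reflection_vec p = x.
Proof.
rewrite /point_reflection_vec [lorentz p x]lorentzC hyperbolic_lorentz divff //.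
by rewrite /n scale1r scaleN1r opprK !scale1r addrK.
Qed.

Lemma point_reflection_vecK : involutive point_reflection_vec.
Proof.
move=> y; rewrite {1}/point_reflection_vec.
rewrite [X in (X / _) *: _](_ : _ = lorentz y x + lorentz y p).
  by rewrite /point_reflection_vec !scale1r opprB addrC subrK.
rewrite /point_reflection_vec /n !lorentzBl.
by rewrite !hyperbolic_lorentz [lorentz p x]lorentzC; field.
Qed.

(** Otherwise [- v], written [0 *: v - 1 *: v] to suit [lorentzBl], lies on the upper sheet, and
    [hcosh_ge1] makes the product of [v] and [y] at least 1. *)
Lemma lorentz_neg_gt0 (v : 'rV[R]_d.+1) (y : H) :
  lorentz v v = -1 -> lorentz v y < 0 -> 0 < v 0 0.
Proof.
move=> vv vy; rewrite ltNge; apply/negP => v0.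
have v00 : v 0 0 != 0.
  apply/eqP => v0E; move: vv; rewrite /lorentz v0E mul0r oppr0 add0r => S.
  have : 0 <= \sum_(i < d) v 0 (lift 0 i) * v 0 (lift 0 i).
    by apply: sumr_ge0 => i _; rewrite -expr2 sqr_ge0.
  by rewrite S; lra.
have wP : (lorentz (0 *: v - 1 *: v) (0 *: v - 1 *: v) == -1) &&
    (0 < (0 *: v - 1 *: v) 0 0).
  rewrite lorentzBl !lorentzBr vv !mxE; apply/andP; split; first by apply/eqP; ring.
  by rewrite mul0r mul1r sub0r oppr_gt0 lt_neqAle v00.
have := hcosh_ge1 (Hyperbolic wP) y; rewrite /= lorentzBl; lra.
Qed.

Lemma point_reflection_subproof (y : H) :
  (lorentz (point_reflection_vec y) (point_reflection_vec y) == -1) &&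
  (0 < point_reflection_vec y 0 0).
Proof.
have yy : lorentz (point_reflection_vec y) (point_reflection_vec y) = -1.
  by rewrite lorentz_point_reflection_vec hyperbolic_lorentz.
rewrite yy eqxx; apply: (lorentz_neg_gt0 (y := x)) => //.
(* As [x] is the image of [p], the product to be tested is that of [y] and [p], which is
   negative. *)
rewrite -point_reflection_vec_base lorentz_point_reflection_vec.
by have := hcosh_ge1 y p; lra.
Qed.

Definition point_reflection_fun (y : H) : H := Hyperbolic (point_reflection_subproof y).

Lemma point_reflection_hisometry_subproof :
  (forall y z, mdist (point_reflection_fun y) (point_reflection_fun z) = mdist y z) /\
  (forall y, exists z, point_reflection_fun z = y).
Proof.
split=> [y z|y].
  rewrite [LHS]/(hdist _ _) [RHS]/(hdist _ _).
  by congr arcosh; rewrite /= lorentz_point_reflection_vec.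
exists (point_reflection_fun y); apply: val_inj => /=.
exact: point_reflection_vecK.
Qed.

(* The reflection through the midpoint of [p] and [x] depends measurably on [x],
   so it is a measurable section of the orbit map [f |-> f p]. *)
Definition point_reflection : hisometry R d :=
  HIsometry point_reflection_hisometry_subproof.

Lemma point_reflection_base : point_reflection p = x.
Proof. by apply: val_inj; exact: point_reflection_vec_base. Qed.

Lemma point_reflectionV : (point_reflection^-1)%g = point_reflection.
Proof.
have h : (point_reflection * point_reflection)%g = 1%g :> hisometry R d.
  by apply: hisometry_eq => y; apply: val_inj; exact: point_reflection_vecK.
by rewrite -[RHS]mul1g -(mulVg point_reflection) -mulgA h mulg1.
Qed.

End point_reflection.
End hyperbolic_geometry.

(** * Measurability of the action on compact sets *)

Section measurability_from_dense_sequences.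
Context (R : realType) (M : metricType R) (J : countType) (u : J -> M).
Hypothesis u_dense : forall (x : M) (e : R), 0 < e -> exists j, mdist x (u j) < e.

Lemma open_bigcup_dense_balls (U : set M) : open U ->
  U = \bigcup_(jn in [set jn : J * nat |
        [set y | mdist (u jn.1) y < jn.2.+1%:R^-1] `<=` U])
      [set y | mdist (u jn.1) y < jn.2.+1%:R^-1].
Proof.
rewrite openE => oU; apply/seteqP; split=> [x Ux|x [jn + xjn]]; last exact.
have := oU x Ux; rewrite /interior -nbhs_ballE => -[e /= e0 eU].
have [|n] := @ltr_add_invr R 0 (e / 2); first by rewrite divr_gt0.
rewrite add0r => ne; have n0 : (0 : R) < n.+1%:R^-1 by rewrite invr_gt0 ltr0n.
have [j xj] := u_dense x n0; exists (j, n); last by rewrite /= metric_sym.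
move=> y /= jy; apply: eU; rewrite ballEmdist /=.
apply: le_lt_trans (metric_triangle _ (u j) _) _.
by rewrite (splitr e) ltrD // (lt_trans _ ne).
Qed.

(** By separability an open set is a countable union of balls with centers [u j] and radii
    [n.+1%:R^-1], so distances to the dense sequence decide measurability. *)
Lemma measurable_preimage_open disp (T : measurableType disp) (g : T -> M) :
  (forall j (e : R), measurable [set t | mdist (u j) (g t) < e]) ->
  forall U, open U -> measurable (g @^-1` U).
Proof.
move=> mg U /open_bigcup_dense_balls ->; rewrite preimage_bigcup bigcup_mkcond.
apply: countable_bigcupT_measurable; first exact: countableP.
by move=> [j n] /=; case: ifP => // _; exact: mg.
Qed.

End measurability_from_dense_sequences.

Section measurable_actions.
Context (R : realType) (d : nat).
Local Notation H := (hyperbolic R d).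
Local Notation I := (hisometry R d).
Local Notation C := (compacts R d).

Lemma open_measurable_hyperbolic (U : set H) : open U -> measurable U.
Proof. exact: sub_sigma_algebra. Qed.

Lemma open_measurable_compacts (U : set C) : open U -> measurable U.
Proof. exact: sub_sigma_algebra. Qed.

Lemma open_mdist_lt (M : metricType R) (x : M) (e : R) :
  open [set y | mdist x y < e].
Proof.
rewrite openE => y /= xy; rewrite /interior -nbhs_ballE.
exists (e - mdist x y); first by rewrite /= subr_gt0.
move=> z; rewrite ballEmdist /= => yz.
by apply: le_lt_trans (metric_triangle _ y _) _; rewrite -ltrBrDl.
Qed.

Lemma measurable_mdist (x : H) : measurable_fun setT (fun y : H => mdist x y).
Proof.
apply: (measurability _ (RGenInftyO.measurableE R)) => _ [_ [r ->] <-].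
rewrite setTI; apply: open_measurable_hyperbolic.
rewrite (_ : _ @^-1` _ = [set y | mdist x y < r]); first exact: open_mdist_lt.
by apply/seteqP; split=> y /=; rewrite in_itv.
Qed.

Lemma measurable_fun_hyperbolic disp (T : measurableType disp) (g : T -> H) :
  (forall x, measurable_fun setT (fun t => mdist x (g t))) ->
  measurable_fun setT g.
Proof.
move=> mg; apply: (measurability (@open H)) => // _ [U oU <-]; rewrite setTI.
apply: (measurable_preimage_open (@hrat_dense R d)) oU => q e.
rewrite (_ : [set _ | _] = (fun t => mdist (hrat R q) (g t)) @^-1` `]-oo, e[%classic).
  by rewrite -[X in measurable X]setTI; apply: mg.
by apply/seteqP; split=> t /=; rewrite in_itv.
Qed.

(** The distance from a test point [z] is [arcosh] of a rational expression in Lorentz products with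
    [x], and each such product is a function of a distance to [x]. *)
Lemma measurable_point_reflection (p y : H) :
  measurable_fun setT (fun x => point_reflection p x y).
Proof.
apply: measurable_fun_hyperbolic => z.
have ml (v : H) : measurable_fun setT (fun x : H => lorentz v x).
  under eq_fun do rewrite lorentz_mdist; apply: measurableT_comp => //.
  apply: measurable_funM => //; apply: measurable_funD.
    by apply: measurableT_comp; [exact: measurable_expR|exact: measurable_mdist].
  apply: measurableT_comp; first exact: measurable_expR.
  by apply: measurableT_comp => //; exact: measurable_mdist.
have m_lt0 (x : H) : lorentz p x - 1 < 0 by have := hcosh_ge1 p x; lra.
(* This is the inverse of the negative number [lorentz p x - 1], expressed through measurable
   functions. *)
pose i (x : H) : R := - expR (- ln (- (lorentz p x - 1))).
have mi : measurable_fun setT i.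
  have mN (f : H -> R) : measurable_fun setT f -> measurable_fun setT (fun x => - f x).
    by move=> mf; apply: measurableT_comp.
  apply: (mN _); apply: (measurableT_comp (@measurable_expR R)); apply: (mN _).
  apply: (measurableT_comp (@measurable_ln R)); apply: (mN _).
  exact: measurable_funB (ml p) (measurable_cst (1 : R)).
rewrite (_ : (fun _ => _) = (fun x : H => arcosh (lorentz z y -
    (lorentz y x + lorentz y p) * i x * (lorentz z x + lorentz z p)))).
  pose m (x : H) : R := lorentz z y - (lorentz y x + lorentz y p) * i x * (lorentz z x + lorentz z p).
  have mm : measurable_fun setT m.
    apply: (measurable_funB (measurable_cst (lorentz z y))).
    apply: measurable_funM; last exact: measurable_funD (ml z) (measurable_cst (lorentz z p)).
    exact: measurable_funM (measurable_funD (ml y) (measurable_cst (lorentz y p))) mi.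
  rewrite /arcosh -/m; apply: measurableT_comp; first exact: measurable_ln.
  apply: measurable_funD => //.
  apply: (measurableT_comp (continuous_measurable_fun (@sqrt_continuous R))).
  exact: measurable_funB (measurable_funX 2 mm) (measurable_cst (1 : R)).
apply/funext => x; rewrite [LHS]/(hdist _ _) /=; congr arcosh.
rewrite /point_reflection_vec lorentzC !lorentzBl.
rewrite /i expRN lnK ?posrE ?oppr_gt0 // invrN opprK.
have := m_lt0 x; rewrite [lorentz x p]lorentzC => /ltr0_neq0 m0.
by rewrite [lorentz x z]lorentzC [lorentz p z]lorentzC [lorentz y z]lorentzC; field.
Qed.

Lemma measurable_mdist_compacts_lt (K : C) (e : R) :
  measurable [set L : C | mdist K L < e].
Proof.
apply: open_measurable_compacts; exact: (@open_mdist_lt C K e).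
Qed.

(** Head and tail are given separately so that the list, hence the finite set, is nonempty; the
    index type remains countable. *)
Definition finite_compact_subproof (q : {ffun 'I_d -> rat} * seq {ffun 'I_d -> rat}) :
  compact (@hrat R d @` [set` q.1 :: q.2]) /\ (@hrat R d @` [set` q.1 :: q.2]) !=set0.
Proof.
split; first by apply: finite_compact; exact/finite_image/finite_seq.
by exists (hrat R q.1), q.1 => //=; rewrite inE eqxx.
Qed.

Definition hrat_compact q : C := Compacts (finite_compact_subproof q).

(** Compactness gives a finite cover of [K] by balls of radius [e / 2] about rational points.
    Discarding the balls that miss [K] leaves centers that are themselves within [e / 2] of [K]. *)
Lemma hrat_compact_dense (K : C) (e : R) : 0 < e ->
  exists q, mdist K (hrat_compact q) < e.
Proof.
move=> e0; have [cK [x0 Kx0]] := csetP K.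
have e20 : 0 < e / 2 by rewrite divr_gt0.

rewrite compact_cover in cK.
have [||D _ DK] := cK _ setT (fun q => [set y | mdist (hrat R q) y < e / 2]).
- by move=> q _; exact: open_mdist_lt.
- by move=> y _; have [q yq] := hrat_dense y e20; exists q => //=; rewrite metric_sym.
pose s : seq {ffun 'I_d -> rat} := [seq q <- finmap.enum_fset D |
  `[< exists2 y, cset K y & mdist (hrat R q) y < e / 2 >]].
have sP y : cset K y -> exists2 q, q \in s & mdist (hrat R q) y < e / 2.
  move=> Ky; have [q qD yq] := DK y Ky; exists q => //.
  by rewrite mem_filter; apply/andP; split=> //; apply/asboolP; exists y.
have [q0 q0s _] := sP _ Kx0.
have [q1 [s1 sE]] : exists q1 s1, s = q1 :: s1.
  by case: (s) q0s => // q1 s1 _; exists q1, s1.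
exists (q1, s1).
apply: (@le_lt_trans _ _ (e / 2)); last by rewrite ltr_pdivrMr // mulr_natr mulr2n ltrDl.
apply: hausdorff_dist_le; rewrite /hausdorff_bound /= -sE; split; first exact: ltW.
- move=> y Ky; have [q qs qy] := sP y Ky; exists (hrat R q); first by exists q.
  by rewrite metric_sym ltW.
- move=> _ [q qs <-]; move: qs; rewrite /= mem_filter => /andP[/asboolP[y Ky qy] _].
  by exists y => //; rewrite metric_sym ltW.
Qed.

(** Replaces the infimum in the Hausdorff distance by a countable union of explicit conditions; the
    strict inequality leaves room for some [n.+1%:R^-1]. *)
Lemma hausdorff_dist_ltP (K L : C) (e : R) :
  mdist K L < e <-> exists n, hausdorff_bound K L (e - n.+1%:R^-1).
Proof.
split=> [KLe|[n] /hausdorff_dist_le].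
  have [|r [r0 KL LK]] := @hausdorff_dist_lt R d K L (e - mdist K L).
    by rewrite subr_gt0.
  rewrite [X in r < X]addrC subrK => re.
  have [n rn] := ltr_add_invr re; exists n.
  have re' : r <= e - n.+1%:R^-1 by rewrite lerBrDr ltW.
  split; first exact: le_trans re'.
  - by move=> x /KL[y Ly xy]; exists y => //; exact: le_trans re'.
  - by move=> x /LK[y Ly xy]; exists y => //; exact: le_trans re'.
by move=> h; apply: le_lt_trans h _; rewrite gtrBl invr_gt0 ltr0n.
Qed.

Section pointwise_measurable_fields.
Context (disp : measure_display) (T : measurableType disp) (phi : T -> I).
Hypothesis mphi : forall x, measurable_fun setT (fun t => phi t x).

(** Between finite sets, a Hausdorff bound is a finite combination of conditions on the distances
    [mdist a (phi t b)]. *)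
Lemma measurable_act_hrat_compact q q' (e : R) :
  measurable [set t | mdist (hrat_compact q') (hisometry_act (phi t) (hrat_compact q)) < e].
Proof.
have mD x y (r : R) : measurable [set t | mdist y (phi t x) <= r].
  rewrite (_ : [set _ | _] = (fun t => mdist y (phi t x)) @^-1` `]-oo, r]%classic).
    rewrite -[X in measurable X]setTI.
    by apply: (measurableT_comp (measurable_mdist y) (mphi x)).
  by apply/seteqP; split=> t /=; rewrite in_itv.
rewrite (_ : [set _ | _] = \bigcup_n [set t | hausdorff_bound (hrat_compact q')
    (hisometry_act (phi t) (hrat_compact q)) (e - n.+1%:R^-1)]); last first.
  apply/seteqP; split=> t /=.
    by move=> /hausdorff_dist_ltP[n h]; exists n.
  by move=> [n _ h]; apply/hausdorff_dist_ltP; exists n.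
apply: bigcup_measurable => n _; set r := e - _.
have [r0|r0] := boolP (0 <= r); last first.
  rewrite (_ : [set _ | _] = set0) //.
  by rewrite -subset0 => t [h]; rewrite h in r0.
rewrite (_ : [set _ | _] =
  (\bigcap_(a in [set` q'.1 :: q'.2]) \bigcup_(b in [set` q.1 :: q.2])
     [set t | mdist (hrat R a) (phi t (hrat R b)) <= r]) `&`
  (\bigcap_(b in [set` q.1 :: q.2]) \bigcup_(a in [set` q'.1 :: q'.2])
     [set t | mdist (hrat R a) (phi t (hrat R b)) <= r])).
  by apply: measurableI; apply: fin_bigcap_measurable => // a _;
    apply: fin_bigcup_measurable.
apply/seteqP; split=> t.
  move=> [_ h1 h2]; split=> a aq.
    have [|_ [_ [b bq <-] <-] ab] := h1 (hrat R a); first by exists a.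
    by exists b.
  have [|_ [b bq <-] ab] := h2 (phi t (hrat R a)).
    by exists (hrat R a) => //; exists a.
  by exists b.
move=> [h1 h2]; split=> //.
  move=> _ [a aq <-]; have [b bq ab] := h1 a aq.
  by exists (phi t (hrat R b)) => //; exists (hrat R b) => //; exists b.
move=> _ [_ [b bq <-] <-]; have [a aq ab] := h2 b bq.
by exists (hrat R a) => //; exists a.
Qed.

(* Since isometries act by isometries on compact sets, [(t, K) |-> phi t K] is a
   Caratheodory function: measurable in [t] and 1-Lipschitz in [K]. *)
Lemma measurable_act :
  measurable_fun setT (fun tK : T * C => hisometry_act (phi tK.1) tK.2).
Proof.
apply: (measurability (@open C)) => // _ [U oU <-]; rewrite setTI.
apply: (measurable_preimage_open hrat_compact_dense) oU => q' e.
(* A countable union of measurable rectangles: [K] is replaced by a finite rational set closer than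
   [n.+1%:R^-1], and the radius shrinks by the same amount. *)
rewrite (_ : [set _ | _] = \bigcup_(qn : _ * nat)
  ([set t | mdist (hrat_compact q') (hisometry_act (phi t) (hrat_compact qn.1)) <
      e - qn.2.+1%:R^-1] `*` [set K | mdist (hrat_compact qn.1) K < qn.2.+1%:R^-1])).
  apply: countable_bigcupT_measurable; first exact: countableP.
  move=> [q n]; apply: measurableX; first exact: measurable_act_hrat_compact.
  exact: measurable_mdist_compacts_lt.
have act (f : I) (K L : C) :
    mdist (hisometry_act f K) (hisometry_act f L) = mdist K L.
  exact: hisometry_act_dist.
apply/seteqP; split=> [[t K] /= h|[t K] [[q n] _ /= [h1 h2]]]; last first.
  apply: le_lt_trans (metric_triangle _ (hisometry_act (phi t) (hrat_compact q)) _) _.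
  by rewrite act -ltrBrDr (lt_trans h1) // ltrD2l ltrN2.
(* Half of the gap, because [n.+1%:R^-1] is spent twice: in the triangle inequality and in the
   shrunken radius. *)
have [|n] := @ltr_add_invr R 0 ((e - mdist (hrat_compact q') (hisometry_act (phi t) K)) / 2).
  by rewrite divr_gt0 // subr_gt0.
rewrite add0r => ne; have n0 : (0 : R) < n.+1%:R^-1 by rewrite invr_gt0 ltr0n.
have [q Kq] := hrat_compact_dense K n0.
exists (q, n) => //; split=> /=; last by rewrite metric_sym.
have := metric_triangle (hrat_compact q') (hisometry_act (phi t) K)
  (hisometry_act (phi t) (hrat_compact q)).
rewrite act; move: ne Kq; set b := n.+1%:R^-1; set a := mdist _ _; lra.
Qed.

End pointwise_measurable_fields.

(** The preimage of an open set is a subbasic set of the compact-open topology, for the compact set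
    [[set x]]. *)
Lemma measurable_hisometry_eval (x : H) : measurable_fun setT (fun f : I => f x).
Proof.
apply: (measurability (@open H)) => // _ [U oU <-]; rewrite setTI.
apply: sub_sigma_algebra.
exists [set h : {compact-open, H -> H} | h @` [set x] `<=` U].
  by apply: compact_open_open => //; exact: compact_set1.
apply/seteqP; split=> f /=; first by move=> h; apply: h; exists x.
by move=> Ufx _ [_ -> <-].
Qed.

(** Since [f] preserves distances, [mdist y (f^-1 x) = mdist x (f y)], which reduces the claim to
    evaluation of [f] itself. *)
Lemma measurable_hisometryV_eval (x : H) :
  measurable_fun setT (fun f : I => (f^-1)%g x).
Proof.
apply: measurable_fun_hyperbolic => y.
rewrite (_ : (fun _ => _) = (fun f : I => mdist x (f y))).
  by apply: (measurableT_comp (measurable_mdist x)); exact: measurable_hisometry_eval.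
apply/funext => f; have ffx : f ((f^-1)%g x) = x by exact: hisometry_inv_funK.
by rewrite metric_sym -[in RHS]ffx (ifunP f).1.
Qed.

End measurable_actions.

(** * Image measures *)

Section image_measures.
Context d1 d2 (T1 : measurableType d1) (T2 : measurableType d2) (R : realType).
Variables (mu : {measure set T1 -> \bar R}) (phi : T1 -> T2).
Hypothesis mphi : measurable_fun setT phi.
Local Open Scope ereal_scope.

Let pushforward_measure : {measure set T2 -> \bar R} :=
  measure_function_pushforward__canonical__measure_function_Measure mu mphi.

(** Change of variables for any [nu] that agrees with the image of [mu] on measurable sets; it
    serves for the Hausdorff measure, [kappa], the intensity measure and [Q] alike. *)
Lemma integral_image (nu : {measure set T2 -> \bar R}) (F : T2 -> \bar R) :
  (forall A, measurable A -> nu A = mu (phi @^-1` A)) ->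
  measurable_fun setT F -> (forall y, 0 <= F y) ->
  \int[nu]_y F y = \int[mu]_x F (phi x).
Proof.
move=> nuE mF F0.
rewrite (eq_measure_integral pushforward_measure); last by move=> A mA _; exact: nuE.
by rewrite ge0_integral_pushforward // preimage_setT.
Qed.

Section image_probability.
Hypothesis mu1 : mu setT = 1.

Definition image_probability of mu setT = 1 : set T2 -> \bar R := pushforward_measure.

HB.instance Definition _ := Measure.copy (image_probability mu1) pushforward_measure.
HB.instance Definition _ :=
  Measure_isProbability.Build _ _ _ (image_probability mu1) mu1.
End image_probability.

Lemma ex_image_probability : mu setT = 1 ->
  exists Q : probability T2 R, forall A, Q A = mu (phi @^-1` A).
Proof. by move=> mu1; exists (image_probability mu1). Qed.

End image_measures.

(** * Sigma-finite measures *)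

Section sigma_finite_measures.
Context d1 (T : measurableType d1) (R : realType).
Variable mu : {measure set T -> \bar R}.

(** The proof is an argument so that the structure required by Tonelli's theorem can be attached to
    the term. *)
Definition sigma_finite_copy of sigma_finite setT mu : set T -> \bar R := mu.

Section instances.
Hypothesis mu_sf : sigma_finite setT mu.
HB.instance Definition _ := Measure.copy (sigma_finite_copy mu_sf) mu.
HB.instance Definition _ :=
  Measure_isSigmaFinite.Build _ _ _ (sigma_finite_copy mu_sf) mu_sf.
End instances.

Lemma ex_sigma_finite_measure : sigma_finite setT mu ->
  exists nu : {sigma_finite_measure set T -> \bar R}, nu = mu :> {measure set T -> \bar R}.
Proof. by move=> mu_sf; exists (sigma_finite_copy mu_sf); exact: eq_measure. Qed.
End sigma_finite_measures.

Section integrals.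
Context disp (T : measurableType disp) (R : realType).
Local Open Scope ereal_scope.

Lemma measurable_fun_indic disp' (U : measurableType disp') (g : U -> T) (A : set T) :
  measurable_fun setT g -> measurable A ->
  measurable_fun setT (fun u => (\1_A (g u) : R)%:E).
Proof.
move=> mg mA; apply/measurable_EFinP.
by apply: (measurableT_comp (f := \1_A : T -> R)) => //; exact: measurable_indic.
Qed.

Lemma measurable_preimage disp' (U : measurableType disp') (g : U -> T) (A : set T) :
  measurable_fun setT g -> measurable A -> measurable (g @^-1` A).
Proof. by move=> mg mA; rewrite -[X in measurable X]setTI; exact: mg. Qed.

Lemma ae_eq_integral_prob (Q : probability T R) (D : set T) (f g : T -> \bar R) :
  measurable D -> Q D = 1 -> measurable_fun setT f -> measurable_fun setT g ->
  (forall x, D x -> f x = g x) -> \int[Q]_x f x = \int[Q]_x g x.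
Proof.
move=> mD QD mf mg fg; apply: ae_eq_integral => //.
have QC : Q (~` D) = 0 by rewrite probability_setC // QD subee.
exists (~` D); split; [exact: measurableC|exact: QC|].
by move=> x /= h Dx; apply: h => _; exact: fg.
Qed.

End integrals.

(** * Typical particles *)

Section hisometry_action.
Context (R : realType) (d : nat).
Local Notation H := (hyperbolic R d).
Local Notation I := (hisometry R d).
Local Notation C := (compacts R d).

Lemma hisometry_actM (f g : I) (K : C) :
  hisometry_act (f * g)%g K = hisometry_act f (hisometry_act g K).
Proof. by apply: compacts_eq; rewrite /= image_comp. Qed.

Lemma hisometry_act1 (K : C) : hisometry_act 1%g K = K.
Proof. by apply: compacts_eq; rewrite /= image_id. Qed.

Lemma hisometry_actK (f : I) : cancel (hisometry_act f) (hisometry_act f^-1%g).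
Proof. by move=> K; rewrite -hisometry_actM mulVg hisometry_act1. Qed.

Lemma hisometryK (f : I) (x : H) : f^-1%g (f x) = x.
Proof. by change ((f^-1 * f)%g x = x); rewrite mulVg. Qed.

Lemma hisometryVK (f : I) (x : H) : f (f^-1%g x) = x.
Proof. by change ((f * f^-1)%g x = x); rewrite mulgV. Qed.

Lemma isotropyV (p : H) (f : I) : isotropy p f -> isotropy p f^-1%g.
Proof. by move=> fp; change (f^-1%g p = p); rewrite -{1}(fp : f p = p) hisometryK. Qed.

Lemma measurable_set1_hyperbolic (x : H) : measurable [set x].
Proof.
rewrite -[X in measurable X]setCK; apply: measurableC; apply: sub_sigma_algebra.
by apply: closed_openC; apply: compact_closed;
  [exact: metric_hausdorff|exact: compact_set1].
Qed.

Lemma measurable_act_pair :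
  measurable_fun setT (fun fK : I * C => hisometry_act fK.1 fK.2).
Proof. exact: measurable_act (@measurable_hisometry_eval R d). Qed.

Lemma measurable_actV_pair :
  measurable_fun setT (fun fK : I * C => hisometry_act (fK.1)^-1%g fK.2).
Proof. exact: measurable_act (@measurable_hisometryV_eval R d). Qed.

End hisometry_action.

Section typical_particles.
Context (R : realType) (d : nat).
Local Notation H := (hyperbolic R d).
Local Notation I := (hisometry R d).
Local Notation C := (compacts R d).
Local Open Scope ereal_scope.
Variables (p : H) (lam : {sigma_finite_measure set I -> \bar R}).
Hypothesis lam_haar : normalized_haar lam.
Variables (kp : probability I R).
Hypothesis kp_haar : isotropy_haar p kp.
Variable c : C -> H.
Hypothesis c_center : center_function c.

Let mc : measurable_fun setT c. Proof. by case: c_center. Qed.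
Let cE f K : c (hisometry_act f K) = f (c K). Proof. by case: c_center. Qed.

(** The normalization of [lam] says that the Hausdorff measure is its image under evaluation at
    [x]. *)
Lemma haar_orbit (x : H) (w : H -> \bar R) :
  measurable_fun setT w -> (forall y, 0 <= w y) ->
  \int[lam]_f w (f x) = \int[@hausdorff_measure R d]_y w y.
Proof.
move=> mw w0; apply/esym/(integral_image (measurable_hisometry_eval x) _ mw w0).
move=> A mA; case: lam_haar => _ _ _ _ /(_ x A mA) E; rewrite [LHS]E.
have mA' := measurable_preimage (measurable_hisometry_eval x) mA.
by have := integral_indic lam measurableT mA'; rewrite setIT => <-.
Qed.

Lemma haar_orbitV (x : H) (w : H -> \bar R) :
  measurable_fun setT w -> (forall y, 0 <= w y) ->
  \int[lam]_f w (f^-1%g x) = \int[@hausdorff_measure R d]_y w y.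
Proof.
move=> mw w0; apply/esym/(integral_image (measurable_hisometryV_eval x) _ mw w0).
move=> A mA; case: lam_haar => _ _ lamV _ /(_ x A mA) E; rewrite [LHS]E.
have mA' := measurable_preimage (measurable_hisometry_eval x) mA.
have := integral_indic lam measurableT mA'; rewrite setIT => E'.
by rewrite [LHS]E' -[LHS](lamV _ mA').
Qed.

Definition orbit_measure (A : set C) (K : C) : \bar R :=
  \int[lam]_f (\1_A (hisometry_act f K))%:E.

Lemma orbit_measure_ge0 A K : 0 <= orbit_measure A K.
Proof. by apply: integral_ge0 => f _; rewrite lee_fin. Qed.

Let measurable_swap_pair : measurable_fun setT (fun Kf : C * I => (Kf.2, Kf.1)).
Proof. by apply: measurable_fun_pair; [exact: measurable_snd|exact: measurable_fst]. Qed.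

Lemma measurable_act_swap :
  measurable_fun setT (fun Kf : C * I => hisometry_act Kf.2 Kf.1).
Proof. exact: (measurableT_comp (@measurable_act_pair R d) measurable_swap_pair). Qed.

Lemma measurable_actV_swap :
  measurable_fun setT (fun Kf : C * I => hisometry_act (Kf.2)^-1%g Kf.1).
Proof. exact: (measurableT_comp (@measurable_actV_pair R d) measurable_swap_pair). Qed.

Lemma measurable_orbit_measure A :
  measurable A -> measurable_fun setT (orbit_measure A).
Proof.
move=> mA; have := @measurable_fun_fubini_tonelli_F _ _ _ _ R lam
  (fun Kf => (\1_A (hisometry_act Kf.2 Kf.1))%:E).
apply; last by move=> Kf; rewrite lee_fin.
exact: (measurable_fun_indic measurable_act_swap mA).
Qed.

Lemma orbit_measureE A K : measurable A ->
  orbit_measure A K = lam ((fun f => hisometry_act f K) @^-1` A).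
Proof.
move=> mA; have mK := measurable_fun_pair1 K (@measurable_act_pair R d).
by have := integral_indic lam measurableT (measurable_preimage mK mA); rewrite setIT => <-.
Qed.

(** Right invariance of [lam] absorbs [h]. *)
Lemma orbit_measure_act A h K : measurable A ->
  orbit_measure A (hisometry_act h K) = orbit_measure A K.
Proof.
move=> mA; rewrite !orbit_measureE //.
have mK := measurable_fun_pair1 K (@measurable_act_pair R d).
case: lam_haar => _ lamr _ _ _; rewrite -[RHS](lamr h _ (measurable_preimage mK mA)).
by congr (lam _); apply/seteqP; split=> f /=; rewrite hisometry_actM.
Qed.

Definition recenter (K : C) : C := hisometry_act (point_reflection p (c K)) K.

Lemma center_recenter K : c (recenter K) = p.
Proof.
rewrite cE; have := hisometryK (point_reflection p (c K)) p.
by rewrite point_reflectionV point_reflection_base.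
Qed.

Lemma measurable_recenter : measurable_fun setT recenter.
Proof.
have mphi x : measurable_fun setT (fun K : C => point_reflection p (c K) x).
  exact: (measurableT_comp (measurable_point_reflection p x) mc).
(* The field of isometries is indexed by the compact sets themselves and evaluated along the
   diagonal [(K, K)]. *)
exact: (measurableT_comp (measurable_act mphi)
  (measurable_fun_pair (@measurable_id _ C setT) (@measurable_id _ C setT))).
Qed.

Lemma measurable_rotation_average_pair :
  measurable_fun setT (fun Kf : C * I => hisometry_act (Kf.2)^-1%g (recenter Kf.1)).
Proof.
have m1 : measurable_fun setT (fun Kf : C * I => recenter Kf.1).
  exact: (measurableT_comp measurable_recenter measurable_fst).
have m2 : measurable_fun setT (fun Kf : C * I => Kf.2) by exact: measurable_snd.
exact: (measurableT_comp (@measurable_actV_pair R d) (measurable_fun_pair m2 m1)).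
Qed.

(** The [kappa] integral in the formula for [Q], with the arbitrary choice [s] replaced by point
    reflections, so that measurability in [K] is available. *)
Definition rotation_average (A : set C) (K : C) : \bar R :=
  \int[kp]_f (\1_A (hisometry_act f^-1%g (recenter K)))%:E.

Lemma rotation_average_ge0 A K : 0 <= rotation_average A K.
Proof. by apply: integral_ge0 => f _; rewrite lee_fin. Qed.

Lemma measurable_rotation_average A : measurable A -> measurable_fun setT (rotation_average A).
Proof.
move=> mA; have := @measurable_fun_fubini_tonelli_F _ _ _ _ R kp
  (fun Kf => (\1_A (hisometry_act (Kf.2)^-1%g (recenter Kf.1)))%:E).
apply; last by move=> Kf; rewrite lee_fin.
exact: (measurable_fun_indic measurable_rotation_average_pair mA).
Qed.

Lemma kp_isotropyE (A : set I) : measurable A -> kp (A `&` isotropy p) = kp A.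
Proof.
move=> mA; case: kp_haar => kp1 _ _; have mp := isotropy_measurable p.
rewrite -[in RHS](setIT A) -(setvU (isotropy p)) setIUr measureU //.
- rewrite [X in _ = X + _](_ : _ = 0) ?add0e //; apply/eqP; rewrite eq_le measure_ge0 andbT.
  apply: (@le_trans _ _ (kp (~` isotropy p))).
    by apply: le_measure; rewrite ?inE //; [apply: measurableI => //|]; exact: measurableC.
  by rewrite probability_setC // kp1 subee.
- by apply: measurableI => //; exact: measurableC.
- exact: measurableI.
- by rewrite setIACA setICl setI0.
Qed.

(* Two isometries mapping [p] to [x] differ by a rotation about [p], so [kappa]
   does not depend on the choice made by [s]. *)
Lemma integral_kappa (s : H -> I) (s_p : forall x, s x p = x) (A : set C) (K : C) (w : R) :
  (0 <= w)%R -> measurable A ->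
  \int[kappa p kp s (c K)]_f ((\1_A (hisometry_act (f^-1)%g K))%:E * w%:E) =
  rotation_average A K * w%:E.
Proof.
move=> w0 mA; pose t := point_reflection p (c K).
have mt := @hisometry_mul_measurable R d t.
have mF : measurable_fun setT (fun f : I => (\1_A (hisometry_act (f^-1)%g K) : R)%:E).
  apply: measurable_fun_indic mA.
  exact: (measurable_fun_pair1 K (@measurable_actV_pair R d)).
rewrite (integral_image (mu := kp) mt (nu := kappa p kp s (c K))).
- rewrite ge0_integralZr //.
  + congr (_ * _); apply: eq_integral => f _; congr (\1_A _)%:E.
    by rewrite invgM point_reflectionV hisometry_actM.
  + by apply: (measurableT_comp mF).
- move=> B mB; have mtB := measurable_preimage mt mB.
  have msB := measurable_preimage (@hisometry_mul_measurable R d (s (c K))) mB.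
  rewrite [LHS](@kappaE R d p kp s (c K) B mB) [LHS](kp_isotropyE msB); case: kp_haar => _ kpl _.
  (* The rotation by which the two choices differ; left invariance of [kp] removes it. *)
  have j : isotropy p (t^-1 * s (c K))%g.
    change (t^-1%g (s (c K) p) = p).
    have tp : t p = c K by exact: point_reflection_base.
    by rewrite s_p -tp hisometryK.
  rewrite -[RHS](kpl _ _ j mtB); congr (kp _).
  by apply/seteqP; split=> f /=; rewrite !mulgA mulgV mul1g.
- apply: (emeasurable_funM mF); exact: measurable_cst.
- by move=> f; rewrite mule_ge0 ?lee_fin.
Qed.

(** * The explicit formula satisfied by every typical particle law *)

Variables (Lam : {sigma_finite_measure set C -> \bar R}) (gamma : R).
Hypothesis gamma_gt0 : (0 < gamma)%R.

(** The disintegration says that [Lam] is the image of [gamma] times [Q \x lam] under the action, so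
    it extends from indicators to nonnegative functions. *)
Lemma integral_typical_particle_law (Q : probability C R) (F : C -> \bar R) :
  typical_particle_law p c lam Lam gamma Q ->
  measurable_fun setT F -> (forall K, 0 <= F K) ->
  \int[Lam]_K F K = gamma%:E * \int[Q]_K \int[lam]_f F (hisometry_act f K).
Proof.
move=> [_ _ LamE] mF F0; have g0 : (0 <= gamma)%R by exact: ltW.
pose mu : {measure set (C * I)%type -> \bar R} := mscale (NngNum g0) (Q \x lam).
rewrite (integral_image (mu := mu) measurable_act_swap) //; last first.
  move=> A mA; rewrite LamE // /mu /mscale /=; congr (_ * _).
  apply: eq_integral => K _; rewrite [LHS]orbit_measureE //; congr (lam _).
  by apply/seteqP; split=> f; rewrite /xsection /= inE.
have mFa := measurableT_comp mF measurable_act_swap.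
rewrite ge0_integral_mscale //; congr (_ * _).
by rewrite fubini_tonelli1.
Qed.

(** After the disintegration is inserted and the integrals are swapped, the integral over [Q] for
    fixed [f] factors as [Q A * w (f p)]; integrating [w (f p)] over [lam] gives the total mass 1 of
    [w]. *)
Lemma typical_particle_lawE (Q : probability C R) (w : H -> R) (A : set C) :
  typical_particle_law p c lam Lam gamma Q ->
  (forall x, (0 <= w x)%R) -> measurable_fun setT w ->
  \int[@hausdorff_measure R d]_x (w x)%:E = 1 ->
  measurable A ->
  Q A = (gamma^-1)%:E * \int[Lam]_K (rotation_average A K * (w (c K))%:E).
Proof.
move=> lawQ w0 mw w1 mA; have [Qp Qinv _] := lawQ.
have mwE : measurable_fun setT (fun x => (w x)%:E) by exact/measurable_EFinP.
have mF : measurable_fun setT (fun K => rotation_average A K * (w (c K))%:E).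
  apply: emeasurable_funM (measurable_rotation_average mA) _.
  exact: (measurableT_comp mwE mc).
have F0 K : 0 <= rotation_average A K * (w (c K))%:E by rewrite mule_ge0 ?rotation_average_ge0 ?lee_fin.
rewrite (integral_typical_particle_law lawQ mF F0).
rewrite (fubini_tonelli (fun Kf => rotation_average A (hisometry_act Kf.2 Kf.1) *
   (w (c (hisometry_act Kf.2 Kf.1)))%:E)) //; last first.
  exact: (measurableT_comp mF measurable_act_swap).
suff inner f : \int[Q]_K (rotation_average A (hisometry_act f K) *
    (w (c (hisometry_act f K)))%:E) = Q A * (w (f p))%:E.
  under eq_integral do rewrite inner.
  rewrite ge0_integralZl //; last 2 first.
  - exact: (measurableT_comp mwE (measurable_hisometry_eval p)).
  - by move=> f _; rewrite lee_fin.
  rewrite (haar_orbit p mwE) // w1 mule1 muleA -EFinM mulVf ?mul1e //.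
  exact: lt0r_neq0.
(* For [K] centered at [p], recentering [f K] yields [h K], and [h] fixes [p]. *)
pose h := (point_reflection p (f p) * f)%g.
have hp : isotropy p h.
  change (point_reflection p (f p) (f p) = p).
  have := hisometryK (point_reflection p (f p)) p.
  by rewrite point_reflectionV point_reflection_base.
have mG : measurable_fun setT (fun Kg : C * I =>
    (\1_A (hisometry_act (Kg.2)^-1%g (hisometry_act h Kg.1)) : R)%:E).
  apply: measurable_fun_indic mA.
  have mh : measurable_fun setT (fun Kg : C * I => (hisometry_act h Kg.1, Kg.2)).
    apply: measurable_fun_pair; last exact: measurable_snd.
    exact: (measurableT_comp (hisometry_act_measurable h) measurable_fst).
  exact: (measurableT_comp measurable_actV_swap mh).
pose G (Kg : C * I) := (\1_A (hisometry_act (Kg.2)^-1%g (hisometry_act h Kg.1)) : R)%:E.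
have G0 Kg : 0 <= G Kg by rewrite lee_fin.
(* The integrands agree where [c K = p], a set of full [Q] measure. *)
transitivity (\int[Q]_K (\int[kp]_g G (K, g) * (w (f p))%:E)).
  apply: (ae_eq_integral_prob (D := c @^-1` [set p])) => //.
  - exact: (measurable_preimage mc (@measurable_set1_hyperbolic R d p)).
  - exact: (measurableT_comp mF (hisometry_act_measurable f)).
  - apply: emeasurable_funM; last exact: measurable_cst.
    exact: (measurable_fun_fubini_tonelli_F G mG G0).
  - move=> K /= cK; congr (_ * _); last by rewrite cE cK.
    by apply: eq_integral => g _; rewrite /recenter cE cK -(hisometry_actM _ f).
rewrite ge0_integralZr //; last 3 first.
- exact: (measurable_fun_fubini_tonelli_F G mG G0).
- by move=> K _; exact: integral_ge0.
- by rewrite lee_fin.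
congr (_ * _); rewrite fubini_tonelli //.
transitivity (\int[kp]_g (cst (Q A) g)); last first.
  by rewrite integral_cst // [X in _ * X](probability_setT kp) mule1.
(* For [kp]-almost every [g] the isometry [g^-1 * h] fixes [p], so invariance of [Q] makes the inner
   integral [Q A]. *)
apply: (ae_eq_integral_prob (D := isotropy p)).
- exact: isotropy_measurable.
- by case: kp_haar.
- exact: (measurable_fun_fubini_tonelli_G G mG G0).
- exact: measurable_cst.
move=> g gp; rewrite /cst -(Qinv (g^-1 * h)%g A _ mA); last first.
  change (g^-1%g (h p) = p); rewrite (hp : h p = p).
  exact: (isotropyV gp).
have mgh := measurable_preimage (hisometry_act_measurable (g^-1 * h)%g) mA.
have := integral_indic Q measurableT mgh; rewrite setIT => <-.
by apply: eq_integral => K _; rewrite /G /= -hisometry_actM.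
Qed.

(** * Existence of a typical particle law *)

Hypothesis Lam_inv : forall (f : I) A, measurable A -> Lam (hisometry_act f @^-1` A) = Lam A.
Variable B : set H.
Hypothesis mB : measurable B.
Hypothesis hausdorffB : hausdorff_measure B = 1.
Hypothesis gammaE : Lam (c @^-1` B) = gamma%:E.

Lemma integral_act_invariant (f : I) (F : C -> \bar R) :
  measurable_fun setT F -> (forall K, 0 <= F K) ->
  \int[Lam]_K F (hisometry_act f K) = \int[Lam]_K F K.
Proof.
move=> mF F0; apply/esym.
apply: (integral_image (hisometry_act_measurable f) _ mF F0) => A mA.
by rewrite -[LHS](Lam_inv f mA).
Qed.

Let mD : measurable (c @^-1` B). Proof. exact: measurable_preimage mc mB. Qed.

(** A transport argument: invariance of [Lam] moves [f] from the condition on [A] to the condition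
    on [B], and for fixed [K] the set of [f] with [f^-1 (c K)] in [B] has [lam] measure
    [hausdorff_measure B = 1]. *)
Lemma integral_orbit_measure (A : set C) : measurable A ->
  \int[Lam]_K ((\1_B (c K))%:E * orbit_measure A K) = Lam A.
Proof.
move=> mA.
have mcV : measurable_fun setT (fun Kf : C * I => c (hisometry_act (Kf.2)^-1%g Kf.1)).
  exact: (measurableT_comp mc measurable_actV_swap).
pose G (Kf : C * I) : \bar R :=
  (\1_B (c (hisometry_act (Kf.2)^-1%g Kf.1)))%:E * (\1_A Kf.1)%:E.
have G0 Kf : 0 <= G Kf by rewrite mule_ge0 ?lee_fin.
have mG : measurable_fun setT G.
  apply: emeasurable_funM (measurable_fun_indic mcV mB) _.
  exact: (measurable_fun_indic measurable_fst mA).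
pose G' (Kf : C * I) : \bar R := (\1_B (c Kf.1))%:E * (\1_A (hisometry_act Kf.2 Kf.1))%:E.
have G'0 Kf : 0 <= G' Kf by rewrite mule_ge0 ?lee_fin.
have mG' : measurable_fun setT G'.
  apply: emeasurable_funM; last exact: (measurable_fun_indic measurable_act_swap mA).
  exact: (measurable_fun_indic (measurableT_comp mc measurable_fst) mB).
transitivity (\int[Lam]_K \int[lam]_f G' (K, f)).
  apply: eq_integral => K _; rewrite /orbit_measure -ge0_integralZl //.
    exact: (measurable_fun_indic (measurable_fun_pair1 K (@measurable_act_pair R d)) mA).
rewrite fubini_tonelli //.
transitivity (\int[lam]_f \int[Lam]_K G (K, f)).
  apply: eq_integral => f _.
  (* Substituting [f K] for [K] turns [G] into [G']. *)
  rewrite -(integral_act_invariant f); last 2 first.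
  - exact: (measurable_fun_pair1 f mG).
  - by move=> K; exact: G0.
  by apply: eq_integral => K _; rewrite /G /G' /= hisometry_actK.
rewrite -fubini_tonelli //.
transitivity (\int[Lam]_K (\1_A K)%:E); last by rewrite integral_indic // setIT.
apply: eq_integral => K _.
transitivity (\int[lam]_f ((\1_B (f^-1%g (c K)))%:E * (\1_A K)%:E)).
  by apply: eq_integral => f _; rewrite /G /= cE.
rewrite ge0_integralZr //; last first.
  exact: (measurable_fun_indic (measurable_hisometryV_eval (c K)) mB).
rewrite (haar_orbitV (c K) (w := fun x => (\1_B x)%:E)) //; last first.
  exact: (measurable_fun_indic (@measurable_id _ H setT) mB).
by rewrite integral_indic // setIT [X in X * _]hausdorffB mul1e.
Qed.

Lemma ex_typical_particle_law :
  exists Q : probability C R, typical_particle_law p c lam Lam gamma Q.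
Proof.
have g0 : (0 <= gamma^-1)%R by rewrite invr_ge0 ltW.
pose m0 : {measure set C -> \bar R} := mscale (NngNum g0) (mrestr Lam mD).
have m0E A : m0 A = (gamma^-1)%:E * Lam (A `&` c @^-1` B) by [].
have [|P0 P0E] := ex_image_probability (@measurable_id _ C setT) (mu := m0).
  by rewrite m0E setTI [X in _ * X]gammaE -EFinM mulVf // lt0r_neq0.
have P0D : P0 (c @^-1` B) = 1.
  by rewrite P0E m0E setIid [X in _ * X]gammaE -EFinM mulVf // lt0r_neq0.
have integral_P0 (F : C -> \bar R) : measurable_fun setT F -> (forall K, 0 <= F K) ->
    \int[P0]_K F K = (gamma^-1)%:E * \int[Lam]_K ((\1_B (c K))%:E * F K).
  move=> mF F0.
  have mBF : measurable_fun setT (fun K => (\1_B (c K))%:E * F K).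
    exact: emeasurable_funM (measurable_fun_indic mc mB) mF.
  have BF : (fun K => (\1_B (c K))%:E * F K) = F \_ (c @^-1` B).
    apply/funext => K; rewrite /patch indicE; change (K \in c @^-1` B) with (c K \in B).
    by case: ifPn => _; rewrite ?mul1e ?mul0e.
  rewrite (ae_eq_integral_prob mD P0D mF mBF); last first.
    by move=> K BK; rewrite indicE mem_set // mul1e.
  rewrite BF -!integral_mkcond.
  rewrite -(ge0_integral_mscale Lam mD (NngNum g0)) //; last first.
    exact: measurable_funTS.
  apply: eq_measure_integral => A mA AD.
  by rewrite [LHS]P0E m0E setIidl.
(* [Q] is the law of a particle drawn from [P0], recentered at [p] and then rotated by an
   independent Haar rotation. *)
have [|Q QE] := ex_image_probability measurable_rotation_average_pair (mu := P0 \x kp).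
  transitivity (\int[P0]_K (cst 1 K)).
    by apply: eq_integral => K _; rewrite /= xsectionE preimage_setT probability_setT.
  by rewrite integral_cst // [X in _ * X](probability_setT P0) mule1.
have QA A : Q A = \int[P0]_K kp ((fun f => hisometry_act f^-1%g (recenter K)) @^-1` A).
  by rewrite QE; apply: eq_integral => K _; rewrite /= xsectionE.
exists Q; split.
- rewrite QA; transitivity (\int[P0]_K (cst 1 K)); last first.
    by rewrite integral_cst // [X in _ * X](probability_setT P0) mule1.
  apply: eq_integral => K _; case: kp_haar => kp1 _ _; rewrite -[RHS]kp1.
  congr (kp _); apply/seteqP; split=> f /=; rewrite cE center_recenter.
    by move=> fp; rewrite /isotropy /= -{1}fp hisometryVK.
  exact: isotropyV.
- move=> j A jp mA; rewrite !QA; apply: eq_integral => K _.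
  have mK := measurable_fun_pair1 (recenter K) (@measurable_actV_pair R d).
  case: kp_haar => _ _ kpr.
  (* Rotating the particle by [j] replaces [f] by [f * j^-1], whose inverse is [j * f^-1]. *)
  rewrite -[RHS](kpr j^-1%g _ (isotropyV jp) (measurable_preimage mK mA)).
  congr (kp _); apply/seteqP; split=> f /=;
    by rewrite invgM invgK hisometry_actM.
move=> A mA; transitivity (gamma%:E * \int[Q]_K orbit_measure A K); last by [].
have mO := measurable_orbit_measure mA.
rewrite (integral_image (mu := P0 \x kp) measurable_rotation_average_pair) //; last 2 first.
- by move=> S _; exact: QE.
- exact: orbit_measure_ge0.
suff -> : \int[P0 \x kp]_Kf
    orbit_measure A (hisometry_act (Kf.2)^-1%g (recenter Kf.1)) = (gamma^-1)%:E * Lam A.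
  by rewrite muleA -EFinM mulfV ?mul1e // lt0r_neq0.
(* Rotation and recentering both leave the orbit measure unchanged. *)
transitivity (\int[P0 \x kp]_Kf orbit_measure A Kf.1).
  by apply: eq_integral => Kf _; rewrite !orbit_measure_act.
rewrite fubini_tonelli1 //; last 2 first.
- exact: (measurableT_comp mO measurable_fst).
- by move=> Kf; exact: orbit_measure_ge0.
transitivity (\int[P0]_K orbit_measure A K).
  apply: eq_integral => K _.
  by rewrite /fubini_F /= integral_cst // [X in _ * X](probability_setT kp) mule1.
by rewrite integral_P0 ?integral_orbit_measure // => K; exact: orbit_measure_ge0.
Qed.

End typical_particles.

(** * Sigma-finiteness and invariance of the Haar and intensity measures *)

Section sigma_finiteness.
Context (R : realType) (d : nat).
Local Notation H := (hyperbolic R d).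
Local Notation I := (hisometry R d).
Local Notation C := (compacts R d).
Local Open Scope ereal_scope.

Lemma measurable_hball (x : H) (r : R) : measurable (hball x r).
Proof.
rewrite (_ : hball x r = (fun y => mdist x y) @^-1` `]-oo, r]%classic).
  by rewrite -[X in measurable X]setTI; apply: measurable_mdist.
by apply/seteqP; split=> y /=; rewrite in_itv.
Qed.

Lemma hausdorff_measure_set1 (x : H) : (0 < d)%N -> hausdorff_measure [set x] = 0.
Proof.
move=> d0; apply/eqP; rewrite eq_le hausdorff_measure_ge0 andbT.
apply: ge_ereal_sup => _ [e /= e0 <-].
have dx : ediam [set x] = 0.
  rewrite /ediam (_ : [set _ | _ in _ & _ in _] = [set 0]) ?ereal_sup1 //.
  apply/seteqP; split=> [_ [y -> [z -> <-]]|_ ->]; first by rewrite mdistxx.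
  by exists x => //; exists x => //; rewrite mdistxx.
apply: ereal_inf_lbound; exists (fun n => if n == 0%N then [set x] else set0).
  split=> [y ->|n]; first by exists 0%N.
  by case: ifP => _; rewrite ?dx ?ediam_set0 ?leNye // lee_fin ltW.
rewrite eseries0 // => -[|n] _ _ /=; last exact: hausdorff_gauge0.
rewrite /hausdorff_gauge; case: ifP => // _; rewrite dx.
by case: d d0 => // n _; rewrite expeS mul0e mule0.
Qed.

(** A ball of nonpositive radius lies in a single point, which is null in positive dimension. A
    positive radius is what lets balls about rational points cover the space. *)
Lemma hball_radius_gt0 (x : H) (r : R) :
  (0 < d)%N -> 0 < hausdorff_measure (hball x r) -> (0 < r)%R.
Proof.
move=> d0; apply: contraTT; rewrite -leNgt -leNgt => r0.
rewrite -(hausdorff_measure_set1 x d0); apply: le_hausdorff_measure => y xy.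
apply/esym/(@mdist_positivity R H)/eqP; rewrite eq_le mdist_ge0 andbT.
exact: le_trans xy r0.
Qed.

Lemma sigma_finite_hball disp (T : measurableType disp) (mu : {measure set T -> \bar R})
    (g : T -> H) (r : R) : (0 < r)%R -> measurable_fun setT g ->
  (forall x, mu (g @^-1` hball x r) < +oo) -> sigma_finite setT mu.
Proof.
move=> r0 mg fin.
exists (fun n => if unpickle n is Some q then g @^-1` hball (hrat R q) r else set0).
  apply/esym; rewrite -subTset => t _; have [q tq] := hrat_dense (g t) r0.
  by exists (pickle q) => //; rewrite pickleK /hball /= metric_sym; exact: ltW.
move=> n; case: (unpickle n) => [q|]; last by rewrite measure0.
by split=> //; exact: (measurable_preimage mg (measurable_hball _ _)).
Qed.

Variables (b : H) (r : R).
Hypothesis r_gt0 : (0 < r)%R.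

Let hball_act (x y : H) : hball x r (point_reflection b x y) <-> hball b r y.
Proof. by rewrite /hball /= -{1}(point_reflection_base b x) (ifunP _).1. Qed.

(** By left invariance under the reflection taking [b] to [x], the isometries sending [b] into the
    ball about [x] have the same measure for every [x], namely the finite volume of the ball about
    [b]. *)
Lemma haar_sigma_finite (lam : {measure set I -> \bar R}) :
  normalized_haar lam -> hausdorff_measure (hball b r) < +oo ->
  sigma_finite setT lam.
Proof.
move=> [laml _ _ _ lamE] fin; apply: (sigma_finite_hball r_gt0
  (@measurable_hisometry_eval R d b)) => x.
have mx z := measurable_preimage (measurable_hisometry_eval b) (measurable_hball z r).
rewrite -(laml (point_reflection b x) _ (mx x)).
rewrite (_ : [set _ | _] = (fun f : I => f b) @^-1` hball b r); last first.
  by apply/seteqP; split=> f; [exact: (hball_act x (f b)).1|exact: (hball_act x (f b)).2].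
have := integral_indic lam measurableT (mx b); rewrite setIT => <-.
by rewrite (lamE b _ (measurable_hball b r)) in fin.
Qed.

Lemma invariant_sigma_finite (Lam : {measure set C -> \bar R}) (c : C -> H) :
  center_function c ->
  (forall (f : I) A, measurable A -> Lam (hisometry_act f @^-1` A) = Lam A) ->
  Lam (c @^-1` hball b r) < +oo -> sigma_finite setT Lam.
Proof.
move=> [mc cE] Lam_inv fin; apply: (sigma_finite_hball r_gt0 mc) => x.
rewrite -(Lam_inv (point_reflection b x)); last first.
  exact: (measurable_preimage mc (measurable_hball x r)).
rewrite (_ : _ @^-1` _ = c @^-1` hball b r) //.
by apply/seteqP; split=> K; rewrite /preimage /= cE;
  [exact: (hball_act x (c K)).1|exact: (hball_act x (c K)).2].
Qed.

Lemma measurable_pmeasure_act (f : I) : measurable_fun setT (@pmeasure_act R d f).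
Proof.
apply: (measurability (@evaluation_sets R d)) => // _ [_ [A mA [U mU <-]] <-].
rewrite !setTI.
have mfA := measurable_preimage (hisometry_act_measurable f) mA.
by rewrite -[X in measurable X]setTI; apply: (evaluation_measurable mfA).
Qed.

(** Both sides integrate the evaluation at [A] against the distribution of [zeta], which
    stationarity identifies with that of the moved process. *)
Lemma intensity_invariant disp (Omega : measurableType disp) (P : probability Omega R)
    (zeta : {mfun Omega >-> pointMeasure R d}) (f : I) (A : set C) :
  stationary P zeta -> measurable A ->
  intensity_measure P zeta (hisometry_act f @^-1` A) = intensity_measure P zeta A.
Proof.
move=> st mA; rewrite /intensity_measure.
have mzeta : measurable_fun setT zeta by exact: measurable_funPT.
have ev0 (m : pointMeasure R d) : 0 <= m A by exact: measure_ge0.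
rewrite -(integral_image mzeta (nu := distribution P zeta) _ (evaluation_measurable mA) ev0) //.
rewrite (integral_image (mu := P) (measurableT_comp (measurable_pmeasure_act f) mzeta)
  (nu := distribution P zeta) _ (evaluation_measurable mA) ev0) //.
by move=> E mE; rewrite -[LHS](st f E mE).
Qed.

End sigma_finiteness.

(** * Existence, uniqueness and explicit form of the typical particle law *)

Local Open Scope ereal_scope.

Theorem theorem2p1 (R : realType) (d : nat) (d_ge2 : (2 <= d)%N)
    (p : hyperbolic R d)
    (lam : {measure set (hisometry R d) -> \bar R}) (lam_haar : normalized_haar lam)
    (kp : probability (hisometry R d) R) (kp_haar : isotropy_haar p kp)
    (s : hyperbolic R d -> hisometry R d) (s_p : forall x, s x p = x)
    (disp : measure_display) (Omega : measurableType disp)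
    (P : probability Omega R)
    (zeta : {mfun Omega >-> pointMeasure R d})
    (zeta_particle : particle_process P zeta)
    (zeta_stationary : stationary P zeta)
    (c : compacts R d -> hyperbolic R d) (c_center : center_function c)
    (b : hyperbolic R d) (r : R) (ball_volume1 : hausdorff_measure (hball b r) = 1)
    (gamma : R) (gamma_gt0 : (0 < gamma)%R)
    (gammaE : \int[intensity_measure P zeta]_K (\1_(hball b r) (c K))%:E
              = gamma%:E) :
  exists Q : probability (compacts R d) R,
    [/\ typical_particle_law p c lam (intensity_measure P zeta) gamma Q,
        forall Q' : probability (compacts R d) R,
          typical_particle_law p c lam (intensity_measure P zeta) gamma Q' ->
          forall A : set (compacts R d), measurable A -> Q' A = Q A
      & forall w : hyperbolic R d -> R,
          (forall x, (0 <= w x)%R) -> measurable_fun setT w ->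
          \int[@hausdorff_measure R d]_x (w x)%:E = 1 ->
          forall A : set (compacts R d), measurable A ->
            Q A = (gamma^-1)%:E * \int[intensity_measure P zeta]_K
              \int[kappa p kp s (c K)]_f
                ((\1_A (hisometry_act (f^-1)%g K))%:E * (w (c K))%:E)].
Proof.
have r0 : (0 < r)%R.
  by apply: (@hball_radius_gt0 R d b); [exact: ltnW | rewrite ball_volume1 lte01].
have mB := measurable_hball b r.
have [mc _] := c_center.
have finB : hausdorff_measure (hball b r) < +oo by rewrite ball_volume1 ltry.
(* [lam'], and below [Lam'], are the given measures bundled with their sigma-finiteness; the
   hypotheses transfer by rewriting. *)
have [lam' lamE] := ex_sigma_finite_measure (haar_sigma_finite r0 lam_haar finB).
pose Lambda : {measure set (compacts R d) -> \bar R} := intensity_measure P zeta.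
have Lam_inv (f : hisometry R d) A : measurable A ->
    Lambda (hisometry_act f @^-1` A) = Lambda A.
  exact: intensity_invariant.
have LamB : Lambda (c @^-1` hball b r) = gamma%:E.
  have := integral_indic Lambda measurableT (measurable_preimage mc mB).
  by rewrite setIT -gammaE => <-.
have finL : Lambda (c @^-1` hball b r) < +oo by rewrite LamB ltry.
have [Lam' LamE] := ex_sigma_finite_measure (invariant_sigma_finite r0 c_center Lam_inv finL).
have lawE Q : typical_particle_law p c lam Lambda gamma Q <->
    typical_particle_law p c lam' Lam' gamma Q.
  by rewrite /typical_particle_law LamE lamE.
have lam'_haar : normalized_haar lam' by rewrite /normalized_haar lamE.
have Lam'_inv (f : hisometry R d) A : measurable A ->
    Lam' (hisometry_act f @^-1` A) = Lam' A.
  by have := Lam_inv f A; rewrite -LamE.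
have Lam'B : Lam' (c @^-1` hball b r) = gamma%:E by have := LamB; rewrite -LamE.
have [Q lawQ] := ex_typical_particle_law lam'_haar kp_haar c_center gamma_gt0
  Lam'_inv mB ball_volume1 Lam'B.
have formula Q' w A := @typical_particle_lawE R d p lam' lam'_haar kp kp_haar c c_center
  Lam' gamma gamma_gt0 Q' w A.
exists Q; split; first exact/lawE.
  move=> Q' /lawE lawQ' A mA.
  (* Uniqueness needs a single weight; the indicator of the ball of volume 1 has integral 1. *)
  have w1 : \int[@hausdorff_measure R d]_x (\1_(hball b r) x)%:E = 1.
    by rewrite integral_indic // setIT.
  have w0 x : (0 <= \1_(hball b r) x :> R)%R by [].
  have mw : measurable_fun setT (\1_(hball b r) : hyperbolic R d -> R).
    exact: measurable_indic.
  by rewrite (formula Q' _ A lawQ' w0 mw w1 mA) (formula Q _ A lawQ w0 mw w1 mA).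
move=> w w0 mw w1 A mA; rewrite (formula Q w A lawQ w0 mw w1 mA).
congr (_ * _).
transitivity (\int[Lambda]_K (rotation_average p kp c A K * (w (c K))%:E)); first by rewrite -LamE.
apply: eq_integral => K _.
exact/esym/(integral_kappa kp_haar _ s_p).
Qed.
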